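(* Let $(X_n)_{n\in\mathbb{N}}$ be a random sequence in $\mathbb{R}^d$, adapted to a filtration $(\mathcal{F}_n)_{n\in\mathbb{N}}$, such that for all $n\ge0$ $$X_{n+1}-X_n=\gamma_{n+1}G_n+c_{n+1}(\varepsilon_{n+1}+r_{n+1}),$$ with $\gamma,c,G,\varepsilon,r$ as in the context. Let $\Gamma$ be an event and suppose that there are a finite random variable $T_0$, $a>2$ and $\rho>0$ such that, almost surely on $\Gamma$, \begin{itemize} \item $\langle X_n,G_n\rangle\ge0$ for all $n\ge T_0$ such that $\|X_n\|<\rho$; \item $0<\liminf_{n\to\infty}\mathbb{E}[\|\varepsilon_n\|^2|\mathcal{F}_{n-1}]$ and $\limsup_{n\to\infty}\mathbb{E}[\|\varepsilon_n\|^a|\mathcal{F}_{n-1}]<\infty$; \item $\sum_n\|r_n\|^2<\infty$. \end{itemize} Then $\mathbb{P}\big[\Gamma\cap\{\lim_{n\to\infty}X_n=0\}\big]=0$.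
   Context: $\langle\cdot,\cdot\rangle$ is an inner product on $\mathbb{R}^d$ with norm $\|\cdot\|$. $(\gamma_n)_{n\ge0}$ and $(c_n)_{n\ge0}$ are non-negative deterministic sequences with $c_n\ne0$ infinitely often and $\sum_nc_n^2<\infty$. $(\varepsilon_n)_{n\ge0}$, $(r_n)_{n\ge0}$ and $(G_n)_{n\ge0}$ are $\mathbb{R}^d$-valued sequences adapted to $(\mathcal{F}_n)$ such that for all $n\ge0$, $\mathbb{E}[\varepsilon_{n+1}|\mathcal{F}_n]=0$ and $\mathbb{E}[\|\varepsilon_{n+1}\|^2|\mathcal{F}_n]<\infty$. *)

(* Defs.v *)
From HB Require Import structures.
From mathcomp Require Import all_boot all_order all_algebra.
From mathcomp Require Import all_classical all_reals all_analysis.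
From mathcomp Require Import measurable_realfun.
Import Order.TTheory GRing.Theory Num.Theory.
Import numFieldNormedType.Exports.

Set Implicit Arguments.
Unset Strict Implicit.
Unset Printing Implicit Defensive.

Local Open Scope classical_set_scope.
Local Open Scope ring_scope.

(* An inner product on R^d is the library's positive definite symmetric
   bilinear form [{dot 'rV[R]_d for idfun}]; this is the norm it induces. *)
Definition dot_norm (R : realType) (d : nat)
    (dot : {dot 'rV[R]_d for idfun}) (u : 'rV[R]_d) : R :=
  Num.sqrt (dot u u).

Definition filtration (disp : measure_display) (T : measurableType disp)
    (F : nat -> set (set T)) : Prop :=
  [/\ forall n, sigma_algebra setT (F n),
      forall n, F n `<=` measurable
    & forall m n, (m <= n)%N -> F m `<=` F n].

(* When [G] is a sigma-algebra, it coincides with the measurable sets of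
   [g_sigma_algebraType G]. *)
Definition measurable_wrt (disp disp' : measure_display)
    (T : measurableType disp) (T' : measurableType disp')
    (G : set (set T)) (f : T -> T') : Prop :=
  measurable_fun setT (f : g_sigma_algebraType G -> T').

(* The Borel sigma-algebra of R^d is the product one, so measurability is
   checked on the coordinates. *)
Definition adapted (disp : measure_display) (T : measurableType disp)
    (R : realType) (d : nat) (F : nat -> set (set T))
    (X : nat -> T -> 'rV[R]_d) : Prop :=
  forall n (i : 'I_d), measurable_wrt (F n) (fun w => X n w ord0 i).

(* [Z] is a version of E[Y | G] for a nonnegative [Y].  Both [Y] and [Z] may
   be infinite or non-integrable. *)
Definition condexp_ge0 (disp : measure_display) (T : measurableType disp)
    (R : realType) (P : probability T R) (G : set (set T))
    (Y Z : T -> \bar R) : Prop :=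
  [/\ measurable_wrt G Z,
      forall w, (0 <= Z w)%E
    & forall A, G A -> (\int[P]_(w in A) Z w = \int[P]_(w in A) Y w)%E].

(* [Z] is a version of E[Y | G] := E[Y^+ | G] - E[Y^- | G], which is defined
   as soon as the difference is almost surely not of the form oo - oo; [Y]
   itself need not be integrable. *)
Definition condexp (disp : measure_display) (T : measurableType disp)
    (R : realType) (P : probability T R) (G : set (set T))
    (Y Z : T -> \bar R) : Prop :=
  measurable_wrt G Z /\
  exists Zp Zm : T -> \bar R,
    [/\ condexp_ge0 P G (Y^\+)%E Zp,
        condexp_ge0 P G (Y^\-)%E Zm
      & {ae P, forall w, (Zp w +? - Zm w)%E /\ Z w = (Zp w - Zm w)%E}].

Definition condexp_vec (disp : measure_display) (T : measurableType disp)
    (R : realType) (d : nat) (P : probability T R) (G : set (set T))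
    (Y Z : T -> 'rV[R]_d) : Prop :=
  forall i : 'I_d,
    condexp P G (fun w => (Y w ord0 i)%:E) (fun w => (Z w ord0 i)%:E).

(* Main.v *)
Require Import Defs.
From HB Require Import structures.
From mathcomp Require Import all_boot all_order all_algebra.
From mathcomp Require Import all_classical all_reals all_analysis.
From mathcomp Require Import measurable_realfun ring lra.
Import Order.TTheory GRing.Theory Num.Theory.
Import numFieldNormedType.Exports.

(** Work on a finite horizon [n <= k < m], starting from an event [B] of [F n], at
    the scale [sigma], where [sigma ^+ 2] is the sum of the [c k.+1 ^+ 2].  Write
    [W k] for [X k + gamma k.+1 G k], which is [F k]-measurable, and suppose that
    on most of [B] the process behaves well up to time [m] and
    [|X m| <= eta * sigma].
    - Projecting [X] on the direction of [W] bounds [|W k|] by an L^2 martingale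
      of variance [O(sigma ^+ 2)].  Hence [|W|] stays below [L * sigma] outside
      a part of [B] of relative size [O(L ^- 2)], and the second moment of [|W k|]
      is [O(sigma ^+ 2)] uniformly in [L].
    - The drift points outward, so [|X m| ^+ 2] dominates, up to errors due to
      [r], the sum of a centered martingale [N] of L^2 norm [O(sigma ^+ 2)]
      and of half of [S], the sum of the [c k.+1 ^+ 2 * |eps k.+1| ^+ 2].  The
      expectation of [S] is at least a constant times [sigma ^+ 2], and by the
      moment of order [a] neither [N] nor [S] concentrates on a small event; so
      [N + S / 2] cannot be small on most of [B].
    Therefore at least a fixed proportion [delta] of [B] escapes.  Intersect
    [Gamma] and the convergence event with uniform versions of the hypotheses.
    Their conditions are [F k]-measurable, so the resulting event is
    approximated by events of the [F n]: if it had positive probability,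
    some [B] would be filled by it up to a proportion less than [delta]. *)

Set Implicit Arguments.
Unset Strict Implicit.
Unset Printing Implicit Defensive.

Local Open Scope classical_set_scope.
Local Open Scope ring_scope.

(** * Inner products *)

Section InnerProduct.
Variables (R : realType) (d : nat) (dot : {dot 'rV[R]_d for idfun}).
Implicit Types u v : 'rV[R]_d.
Local Notation nrm := (dot_norm dot).

Lemma dotC u v : dot u v = dot v u.
Proof. by rewrite hermC/= expr0 mul1r. Qed.

Lemma dot_gt0 u : u != 0 -> 0 < dot u u.
Proof. exact: neq0_dnorm_gt0. Qed.

Lemma dot_ge0 u : 0 <= dot u u.
Proof.
by have [->|/dot_gt0/ltW//] := eqVneq u 0; rewrite linear0l.
Qed.

Lemma sqr_dot_norm u : nrm u ^+ 2 = dot u u.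
Proof. by rewrite sqr_sqrtr// dot_ge0. Qed.

Lemma dot_norm_ge0 u : 0 <= nrm u.
Proof. exact: sqrtr_ge0. Qed.

Lemma dot_norm0 : nrm 0 = 0.
Proof. by rewrite /dot_norm linear0l sqrtr0. Qed.

Lemma dot_norm_eq0 u : nrm u = 0 -> u = 0.
Proof.
have [//|/dot_gt0 u0 nu] := eqVneq u 0.
by move: u0; rewrite -sqr_dot_norm nu expr0n ltxx.
Qed.

Lemma dotZl (a : R) u v : dot (a *: u) v = a * dot u v.
Proof. by rewrite linearZl_LR. Qed.

Lemma dotZr (a : R) u v : dot u (a *: v) = a * dot u v.
Proof. by rewrite dotC dotZl dotC. Qed.

Lemma dotDl u1 u2 v : dot (u1 + u2) v = dot u1 v + dot u2 v.
Proof. by rewrite linearDl. Qed.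

Lemma dotDr u v1 v2 : dot u (v1 + v2) = dot u v1 + dot u v2.
Proof. by rewrite linearDr. Qed.

Lemma dot_normZ (a : R) u : nrm (a *: u) = `|a| * nrm u.
Proof.
by rewrite /dot_norm dotZl dotZr mulrA -expr2 sqrtrM ?sqr_ge0// sqrtr_sqr.
Qed.

(** Cauchy-Schwarz: positivity at [nrm v *: u - nrm u *: v] is, up to a factor 2, the claim
    multiplied by [nrm u * nrm v]; hence zero norms are treated first. *)
Lemma dot_le u v : dot u v <= nrm u * nrm v.
Proof.
have [u0|u0] := eqVneq (nrm u) 0.
  by rewrite (dot_norm_eq0 u0) linear0l mulr_ge0// dot_norm_ge0.
have [v0|v0] := eqVneq (nrm v) 0.
  by rewrite (dot_norm_eq0 v0) linear0r mulr_ge0// dot_norm_ge0.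
have uv0 : 0 < nrm u * nrm v by rewrite mulr_gt0// lt0r ?u0 ?v0 dot_norm_ge0.
have := dot_ge0 (nrm v *: u - nrm u *: v).
rewrite -scaleNr !(dotDl, dotDr, dotZl, dotZr) -!sqr_dot_norm (dotC v u) => h.
have {h} : 0 <= (nrm u * nrm v) * (nrm u * nrm v - dot u v).
  move: h; set x := nrm u; set y := nrm v; set z := dot u v => h; nra.
by rewrite pmulr_rge0// subr_ge0.
Qed.

Lemma normr_dot_le u v : `|dot u v| <= nrm u * nrm v.
Proof.
rewrite ler_norml dot_le andbT lerNl.
rewrite -mulN1r -dotZl (le_trans (dot_le _ _))// dot_normZ normrN1 mul1r.
by [].
Qed.

Lemma dot_coord u v :
  dot u v = \sum_i \sum_j u ord0 i * v ord0 j * dot 'e_i 'e_j.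
Proof.
rewrite {1}(row_sum_delta u) (big_morph (dot^~ v) (id1 := 0) (op1 := +%R))//=;
  last first.
- exact: linear0l.
- by move=> x y; exact: dotDl.
apply: eq_bigr => i _; rewrite dotZl {1}(row_sum_delta v) linear_sum/= mulr_sumr.
by apply: eq_bigr => j _; rewrite dotZr mulrA.
Qed.

(* The Gram matrix is invertible, so each coordinate is represented by a
   vector, and Cauchy-Schwarz applies. *)
Lemma coord_le_dot_norm :
  exists2 C : R, 0 <= C & forall u i, `|u ord0 i| <= C * nrm u.
Proof.
pose A : 'M[R]_d := \matrix_(i, j) dot 'e_i 'e_j.
have dotA u v : dot u v = (u *m A *m v^T) ord0 ord0.
  rewrite dot_coord mxE exchange_big/=; apply: eq_bigr => j _.
  rewrite mxE mulr_suml; apply: eq_bigr => i _.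
  by rewrite !mxE; ring.
(* A row vector in the left kernel of the Gram matrix has zero product with itself. *)
have Au : A \in unitmx.
  rewrite -row_free_unit -kermx_eq0; apply/rowV0P => u /sub_kermxP uA.
  by apply/eqP; apply: contraT => /dot_gt0;
    rewrite dotA uA mul0mx mxE ltxx.
pose b i : 'rV[R]_d := ('e_i *m (invmx A)^T).
exists (\sum_i nrm (b i)); first by apply: sumr_ge0 => i _; exact: dot_norm_ge0.
move=> u i; have -> : u ord0 i = dot u (b i).
  by rewrite dotA trmx_mul trmxK mulmxA mulmxK// trmx_delta -colE mxE.
rewrite (le_trans (normr_dot_le _ _))// mulrC ler_wpM2r ?dot_norm_ge0//.
by rewrite (bigD1 i)//= lerDl sumr_ge0// => j _; exact: dot_norm_ge0.
Qed.

End InnerProduct.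

(** * Sub-sigma-algebras *)

Lemma fin_neq0_mule_def (R : realType) (x : R) (y : \bar R) :
  x != 0 -> (x%:E *? y)%E.
Proof. by case: y. Qed.

Section SubSigmaAlgebra.
Variables (disp : measure_display) (T : measurableType disp).

Lemma measurable_wrtT (disp' : measure_display) (T' : measurableType disp')
    (G : set (set T)) (f : T -> T') :
  sigma_algebra setT G -> G `<=` measurable ->
  measurable_wrt G f -> measurable_fun setT f.
Proof.
move=> sG subG mf _ Y mY; rewrite setTI; apply: subG.
rewrite -(measurable_g_measurableTypeE sG) -[X in _ X]setTI.
exact: mf.
Qed.

Lemma measurable_wrt_preimage (disp' : measure_display)
    (T' : measurableType disp') (G : set (set T)) (f : T -> T') (Y : set T') :
  sigma_algebra setT G -> measurable_wrt G f -> measurable Y -> G (f @^-1` Y).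
Proof.
move=> sG mf mY.
rewrite -(measurable_g_measurableTypeE sG) -[X in _ X]setTI.
exact: mf.
Qed.

Lemma measurable_wrtS (disp' : measure_display) (T' : measurableType disp')
    (G H : set (set T)) (f : T -> T') :
  sigma_algebra setT G -> sigma_algebra setT H -> G `<=` H ->
  measurable_wrt G f -> measurable_wrt H f.
Proof.
move=> sG sH GH mf _ Y mY; rewrite setTI.
rewrite [measurable](measurable_g_measurableTypeE sH); apply: GH.
exact: measurable_wrt_preimage.
Qed.

Lemma measurable_wrt_indic (R : realType) (G : set (set T)) (A : set T) :
  sigma_algebra setT G -> G A -> measurable_wrt G (\1_A : T -> R).
Proof.
move=> sG GA; apply: (@measurable_indic _ (g_sigma_algebraType G)).
by rewrite [measurable](measurable_g_measurableTypeE sG).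
Qed.

Section Events.
Variables (R : realType) (G : set (set T)).
Hypothesis sG : sigma_algebra setT G.

(** The closure lemmas below serve both for each [F k] and for the sigma-algebra of approximable
    events. *)
Lemma eventP (A : set T) : G A <-> measurable (A : set (g_sigma_algebraType G)).
Proof. by rewrite [measurable](measurable_g_measurableTypeE sG). Qed.

Lemma event_lee (f g : T -> \bar R) :
  measurable_wrt G f -> measurable_wrt G g -> G [set w | (f w <= g w)%E].
Proof.
move=> mf mg; apply/eventP; rewrite -[X in measurable X]setTI.
exact: (@measurable_lee _ (g_sigma_algebraType G)).
Qed.

Lemma event_le (f g : T -> R) :
  measurable_wrt G f -> measurable_wrt G g -> G [set w | f w <= g w].
Proof.
move=> mf mg; have := @event_lee (EFin \o f) (EFin \o g).
by apply; exact/measurable_EFinP.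
Qed.

Lemma event_eq (f g : T -> R) :
  measurable_wrt G f -> measurable_wrt G g -> G [set w | f w = g w].
Proof.
move=> mf mg; have -> : [set w | f w = g w] =
    [set w | f w <= g w] `&` [set w | g w <= f w].
  apply/seteqP; split=> w /= => [->|[fg gf]]; first by rewrite lexx.
  by apply/eqP; rewrite eq_le fg.
by apply/eventP; apply: measurableI; apply/eventP; exact: event_le.
Qed.

Lemma eventI (A B : set T) : G A -> G B -> G (A `&` B).
Proof.
move=> /eventP mA /eventP mB; apply/eventP.
exact: (@measurableI _ (g_sigma_algebraType G)).
Qed.

Lemma eventD (A B : set T) : G A -> G B -> G (A `\` B).
Proof.
move=> /eventP mA /eventP mB; apply/eventP.
exact: (@measurableD _ (g_sigma_algebraType G)).
Qed.

Lemma eventU (A B : set T) : G A -> G B -> G (A `|` B).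
Proof.
move=> /eventP mA /eventP mB; apply/eventP.
exact: (@measurableU _ (g_sigma_algebraType G)).
Qed.

Lemma event_forall (Q : nat -> T -> Prop) :
  (forall k, G [set w | Q k w]) -> G [set w | forall k, Q k w].
Proof.
move=> GQ; have -> : [set w | forall k, Q k w] = \bigcap_k [set w | Q k w].
  by apply/seteqP; split=> w /= h k; [move=> _; exact: h|exact: h].
by apply/eventP; apply: bigcapT_measurable => k; exact/eventP.
Qed.

Lemma event_exists (Q : nat -> T -> Prop) :
  (forall k, G [set w | Q k w]) -> G [set w | exists k, Q k w].
Proof.
move=> GQ; have -> : [set w | exists k, Q k w] = \bigcup_k [set w | Q k w].
  by apply/seteqP; split=> w /= [k]; [exists k|move=> _; exists k].
by apply/eventP; apply: bigcupT_measurable => k; exact/eventP.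
Qed.

Lemma event_imp (b : bool) (Q : T -> Prop) :
  G [set w | Q w] -> G [set w | b -> Q w].
Proof.
case: b => GQ; first by rewrite (_ : mkset _ = [set w | Q w])//;
  apply/seteqP; split=> w /= h; [exact: h|move=> _].
have -> : [set w | false -> Q w] = setT by apply/seteqP.
by apply/eventP; exact: measurableT.
Qed.

End Events.

Variables (R : realType) (P : probability T R).

(** * Pulling a measurable factor out of a conditional expectation *)

Section PullOut.
Import HBNNSimple.
Local Open Scope ereal_scope.
Variables (G : set (set T)).
Hypotheses (sG : sigma_algebra setT G) (subG : G `<=` measurable).
Variables (g h : T -> \bar R).
Hypotheses (mg : measurable_fun setT g) (mh : measurable_fun setT h).
Hypotheses (g0 : forall w, 0 <= g w) (h0 : forall w, 0 <= h w).
Hypothesis gh : forall A, G A -> \int[P]_(w in A) g w = \int[P]_(w in A) h w.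

Let sG_type := g_sigma_algebraType G.

(** Reduction of a simple weight to its level sets, which belong to [G] and are where [gh]
    applies. *)
Let int_nnsfun (f : {nnsfun sG_type >-> R}) (k : T -> \bar R) :
  measurable_fun setT k -> (forall w, 0 <= k w) ->
  \int[P]_w ((f w)%:E * k w) =
  \sum_(y \in range f) (y%:E * \int[P]_(w in f @^-1` [set y]) k w).
Proof.
move=> mk k0.
have mpre y : measurable (f @^-1` [set y] : set T).
  by apply: subG; apply: measurable_wrt_preimage => //; exact: measurable_funPT.
have m1 y : measurable_fun setT
    (fun w : T => (\1_(f @^-1` [set y] : set T) w : R)%:E).
  by apply/measurable_EFinP; exact: measurable_indic.
transitivity (\int[P]_w \sum_(y \in range f)
    (y%:E * (\1_(f @^-1` [set y]) w)%:E * k w)).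
  apply: eq_integral => w _; rewrite {1}(fimfunE f w) -fsumEFin//.
  rewrite fsbig_finite//= ge0_sume_distrl => [|y _].
    by rewrite fsbig_finite.
  exact: nnfun_muleindic_ge0.
rewrite ge0_integral_fsum//; last 2 first.
- by move=> y; apply: emeasurable_funM => //; exact: measurable_funeM.
- by move=> y w _; rewrite mule_ge0//; exact: nnfun_muleindic_ge0.
apply: eq_fsbigr => y; rewrite inE => -[w _ fwy].
have y0 : (0 <= y)%R by rewrite -fwy.
under eq_integral do rewrite -muleA.
rewrite ge0_integralZl_EFin//; last 2 first.
- by move=> z _; rewrite mule_ge0// lee_fin.
- exact: emeasurable_funM.
congr (_ * _); rewrite [RHS]integral_mkcond; apply: eq_integral => z _.
rewrite patchE indicE; case: (z \in _); first by rewrite mul1e.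
by rewrite mul0e.
Qed.

(** Level sets settle simple weights, and monotone convergence the rest. Integrals stay extended
    because neither [g] nor [h] is assumed integrable. *)
Lemma pull_out (f : T -> R) : measurable_wrt G f -> (forall w, 0 <= f w)%R ->
  \int[P]_w ((f w)%:E * g w) = \int[P]_w ((f w)%:E * h w).
Proof.
move=> mf f0; have mf' : measurable_fun setT (EFin \o f : sG_type -> \bar R).
  exact/measurable_EFinP.
have f0' w : setT w -> 0 <= (EFin \o f) w by rewrite lee_fin.
pose s := nnsfun_approx measurableT mf'.
have ms n : measurable_fun setT (s n : T -> R).
  apply: (@measurable_wrtT _ _ G) => //; exact: measurable_funPT.
have cvg_s k : measurable_fun setT k -> (forall w, 0 <= k w) ->
    \int[P]_w ((s n w)%:E * k w) @[n --> \oo] -->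
    \int[P]_w ((f w)%:E * k w).
  move=> mk k0.
  have -> : \int[P]_w ((f w)%:E * k w) =
      \int[P]_w limn (fun n => (s n w)%:E * k w).
    apply: eq_integral => w _; apply/esym/cvg_lim => //.
    have cs : (s n w)%:E @[n --> \oo] --> (f w)%:E.
      exact: (cvg_nnsfun_approx measurableT mf' f0').
    have [fw0|fw0] := eqVneq (f w) 0%R.
      rewrite fw0 mul0e; under eq_fun => n.
        have -> : s n w = 0%R.
          apply/eqP; rewrite eq_le; apply/andP; split=> //.
          rewrite -lee_fin -fw0 nnsfun_approxE.
          exact: (@le_approx _ _ _ _ _ _ _ f0').
        rewrite mul0e; over.
      exact: cvg_cst.
    apply: cvgeM => //; first exact: fin_neq0_mule_def.
    exact: cvg_cst.
  apply: cvg_monotone_convergence => //.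
  - by move=> n; apply: emeasurable_funM => //; exact/measurable_EFinP.
  - by move=> n w _; rewrite mule_ge0// lee_fin.
  - move=> w _ m n mn; rewrite lee_wpmul2r// lee_fin.
    by have /lefP := nd_nnsfun_approx measurableT mf' mn; exact.
have := cvg_s g mg g0; have := cvg_s h mh h0.
rewrite (_ : (fun n => \int[P]_w ((s n w)%:E * g w)) =
  (fun n => \int[P]_w ((s n w)%:E * h w))); last first.
  apply/funext => n; rewrite !int_nnsfun//; apply: eq_fsbigr => y _.
  rewrite gh//; apply: measurable_wrt_preimage => //.
  exact: measurable_funPT.
by move=> /cvg_lim <- // /cvg_lim <-.
Qed.

End PullOut.
End SubSigmaAlgebra.

(** * Real-valued expectations *)

Section Expectation.
Variables (disp : measure_display) (T : measurableType disp) (R : realType).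
Variable P : probability T R.
Implicit Types f g : T -> R.

Local Notation integ f := (P.-integrable setT (EFin \o f)).

Lemma integ_le f g :
  measurable_fun setT f -> (forall w, `|f w| <= g w) -> integ g -> integ f.
Proof.
move=> mf fg; apply: le_integrable => //; first exact/measurable_EFinP.
by move=> w _/=; rewrite lee_fin (le_trans (fg w))// ler_norm.
Qed.

Lemma integ_cst (r : R) : integ (cst r).
Proof. exact: finite_measure_integrable_cst. Qed.

Lemma integ_bounded f (b : R) :
  measurable_fun setT f -> (forall w, `|f w| <= b) -> integ f.
Proof. by move=> mf fb; apply: (@integ_le _ (cst b)) => //; exact: integ_cst. Qed.

Lemma integ_add f g : integ f -> integ g -> integ (fun w => f w + g w).
Proof. by move=> /integrableD h /h; exact. Qed.

Lemma integ_scale (r : R) f : integ f -> integ (fun w => r * f w).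
Proof. by move=> /(@integrableZl _ _ _ _ _ measurableT r). Qed.

Lemma integ_sum (f : nat -> T -> R) k l :
  (forall j, integ (f j)) -> integ (fun w => \sum_(k <= j < l) f j w).
Proof.
move=> fi; apply: (@eq_integrable _ _ _ _ _ measurableT
  (fun w => \sum_(k <= j < l) (f j w)%:E)%E).
  by move=> w _ /=; rewrite sumEFin.
by apply: integrable_sum => // j _; exact: fi.
Qed.

Lemma Rint_sum (f : nat -> T -> R) k l : (forall j, integ (f j)) ->
  \int[P]_w (\sum_(k <= j < l) f j w) = \sum_(k <= j < l) \int[P]_w f j w.
Proof.
move=> fi; elim: l => [|l ih].
  rewrite big_geq//; under eq_Rintegral do rewrite big_geq//.
  by rewrite Rintegral_cst// mul0r.
have [kl|lk] := leqP k l; last first.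
  rewrite big_geq//; under eq_Rintegral do rewrite big_geq//.
  by rewrite Rintegral_cst// mul0r.
rewrite big_nat_recr//= -ih -RintegralD//; last exact: integ_sum.
by apply: eq_Rintegral => w _; rewrite big_nat_recr.
Qed.

Lemma Rint_indic (A : set T) : measurable A -> \int[P]_w \1_A w = fine (P A).
Proof. by move=> mA; rewrite /Rintegral integral_indic// setIT. Qed.

Lemma integ_indic (A : set T) : measurable A -> integ (\1_A : T -> R).
Proof. by move=> mA; exact: integrable_indic. Qed.

Lemma le_Rint f g : integ f -> integ g -> (forall w, f w <= g w) ->
  \int[P]_w f w <= \int[P]_w g w.
Proof. by move=> fi gi fg; apply: le_Rintegral. Qed.

Lemma EFin_Rint f : integ f -> (\int[P]_w (f w)%:E = (\int[P]_w f w)%:E)%E.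
Proof. by move=> fi; rewrite /Rintegral fineK//; exact: integrable_fin_num. Qed.

(** Conditional expectations are handled through extended integrals; this is the way back to real
    ones. *)
Lemma integ_of_le f (x : R) : measurable_fun setT f -> (forall w, 0 <= f w) ->
  (\int[P]_w (f w)%:E <= x%:E)%E -> integ f /\ \int[P]_w f w <= x.
Proof.
move=> mf f0 fx; have fi : integ f.
  apply/integrableP; split; first exact/measurable_EFinP.
  under eq_integral => w _ do rewrite /= ger0_norm//.
  exact: (le_lt_trans fx (ltry _)).
by split => //; rewrite -lee_fin -EFin_Rint.
Qed.

Definition sq_integ f := measurable_fun setT f /\ integ (fun w => f w ^+ 2).

Lemma sq_integ_mul f g : sq_integ f -> sq_integ g -> integ (fun w => f w * g w).
Proof.
move=> [mf f2] [mg g2].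
apply: (@integ_le _ (fun w => f w ^+ 2 + g w ^+ 2)).
- exact: measurable_funM.
- by move=> w; rewrite ler_norml; apply/andP; split; nra.
- exact: integ_add.
Qed.

Lemma sq_integ_add f g :
  sq_integ f -> sq_integ g -> sq_integ (fun w => f w + g w).
Proof.
move=> [mf f2] [mg g2]; split; first exact: measurable_funD.
apply: (@integ_le _ (fun w => 2 * f w ^+ 2 + 2 * g w ^+ 2)).
- by apply: measurable_funX; exact: measurable_funD.
- by move=> w; rewrite ger0_norm ?sqr_ge0//; have := sqr_ge0 (f w - g w); nra.
- by apply: integ_add; exact: integ_scale.
Qed.

Lemma sq_integ_le f g : measurable_fun setT f -> (forall w, `|f w| <= `|g w|) ->
  sq_integ g -> sq_integ f.
Proof.
move=> mf fg [mg g2]; split => //; apply: integ_le g2.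
  exact: measurable_funX.
move=> w; rewrite ger0_norm ?sqr_ge0// -(real_normK (num_real (f w))).
by rewrite -(real_normK (num_real (g w))) lerXn2r ?nnegrE.
Qed.

Lemma sq_integ_integ f : sq_integ f -> integ f.
Proof.
move=> f2; have : sq_integ (cst 1 : T -> R).
  split => //; apply: (@integ_bounded _ 1) => [|w]; last by rewrite expr1n normr1.
  exact: measurable_funX.
move=> /(sq_integ_mul f2); apply: eq_integrable => // w _ /=.
by rewrite mulr1.
Qed.

End Expectation.
Arguments sq_integ {disp T R} P f.

(** * Moments of the noise *)

(** The threshold [y] is chosen so that its power [a - 2] is [theta^-1]: below it [y ^+ 2]
    dominates, above it the surplus power [a - 2] of [x] makes up for [theta]. With [theta] small
    this gives uniform integrability of the squared noise. *)
Lemma sqr_le_powR (R : realType) (a theta : R) : 2 < a -> 0 < theta ->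
  exists2 Lam : R, 0 <= Lam &
    forall x, 0 <= x -> x ^+ 2 <= Lam + theta * x `^ a.
Proof.
move=> a2 t0; pose y := theta^-1 `^ (a - 2)^-1.
exists (y ^+ 2) => [|x x0]; first exact: sqr_ge0.
have [xy|yx] := leP x y.
  rewrite (@le_trans _ _ (y ^+ 2))//; first by rewrite lerXn2r// nnegrE powR_ge0.
  by rewrite lerDl mulr_ge0 ?powR_ge0// ltW.
have y0 : 0 <= y by exact: powR_ge0.
have x_gt0 : 0 < x by exact: le_lt_trans yx.
rewrite -[leLHS]add0r lerD ?sqr_ge0//.
have -> : x `^ a = x `^ (a - 2) * x ^+ 2.
  have := @powRD R x (a - 2) 2.
  by rewrite subrK powR_mulrn//; apply; rewrite (gt_eqF x_gt0) implybT.
rewrite mulrA ler_peMl ?sqr_ge0//.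
have : y `^ (a - 2) <= x `^ (a - 2).
  by apply: ge0_ler_powR; rewrite ?nnegrE//; [rewrite subr_ge0 ltW|exact: ltW].
rewrite /y -powRrM mulVf ?subr_eq0 ?gt_eqF// powRr1; last by rewrite invr_ge0 ltW.
by rewrite -ler_pdivrMl// mulr1.
Qed.

Section Measurability.
Variables (R : realType) (d : nat) (dot : {dot 'rV[R]_d for idfun}).
Variables (disp : measure_display) (T : measurableType disp).

Lemma measurable_dot (u v : T -> 'rV[R]_d) :
  (forall i, measurable_fun setT (fun w => u w ord0 i)) ->
  (forall i, measurable_fun setT (fun w => v w ord0 i)) ->
  measurable_fun setT (fun w => dot (u w) (v w)).
Proof.
move=> mu mv; under eq_fun do rewrite dot_coord.
apply: measurable_sum => i; apply: measurable_sum => j.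
by apply: measurable_funM => //; exact: measurable_funM.
Qed.

Lemma measurable_dot_norm (u : T -> 'rV[R]_d) :
  (forall i, measurable_fun setT (fun w => u w ord0 i)) ->
  measurable_fun setT (fun w => dot_norm dot (u w)).
Proof.
move=> mu; apply: (@measurableT_comp _ _ _ _ _ _ (@Num.sqrt R)).
  by apply: continuous_measurable_fun; exact: sqrt_continuous.
exact: measurable_dot.
Qed.

End Measurability.

Section NoiseStep.
Variables (R : realType) (d : nat) (dot : {dot 'rV[R]_d for idfun}).
Variables (disp : measure_display) (T : measurableType disp).
Variables (P : probability T R) (G : set (set T)).
Hypotheses (sG : sigma_algebra setT G) (subG : G `<=` measurable).
Variable e : T -> 'rV[R]_d.
Hypothesis me : forall i, measurable_fun setT (fun w => e w ord0 i).
Local Notation nrm := (dot_norm dot).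
Local Notation integ f := (P.-integrable setT (EFin \o f)).

Let mne : measurable_fun setT (fun w => nrm (e w)).
Proof. exact: measurable_dot_norm. Qed.

Lemma condexp_ge0_pull_out (Y Z : T -> \bar R) (f : T -> R) :
  measurable_fun setT Y -> (forall w, 0 <= Y w)%E -> condexp_ge0 P G Y Z ->
  measurable_wrt G f -> (forall w, 0 <= f w) ->
  (\int[P]_w ((f w)%:E * Y w) = \int[P]_w ((f w)%:E * Z w))%E.
Proof.
move=> mY Y0 [mZ Z0 ZY] mf f0; apply: (pull_out sG) => //.
- exact: measurable_wrtT mZ.
- by move=> A GA; rewrite ZY.
Qed.

Section Moments.
Variables (a : R) (V2 Va : T -> \bar R).
Hypothesis hV2 : condexp_ge0 P G (fun w => (nrm (e w) ^+ 2)%:E) V2.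
Hypothesis hVa : condexp_ge0 P G (fun w => (nrm (e w) `^ a)%:E) Va.

Let mea : measurable_fun setT (fun w => nrm (e w) `^ a).
Proof. exact: (measurableT_comp (measurable_powR a)). Qed.

(** The weight [f] vanishes wherever the conditional moment exceeds [K], so once [f] is pulled out,
    [Va] can be replaced by [K]. *)
Lemma moment_a_le (f : T -> R) (K b : R) : measurable_wrt G f ->
  (forall w, 0 <= f w <= b) -> (forall w, f w != 0 -> (Va w <= K%:E)%E) ->
  integ (fun w => f w * nrm (e w) `^ a) /\
  \int[P]_w (f w * nrm (e w) `^ a) <= K * \int[P]_w f w.
Proof.
move=> mf fb fVa.
have f0 w : 0 <= f w by have /andP[] := fb w.
have mfT : measurable_fun setT f by exact: measurable_wrtT mf.
have mVa : measurable_fun setT Va by case: hVa => m _ _; exact: measurable_wrtT m.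
have fi : integ f.
  apply: (@integ_bounded _ _ _ P _ b) => // w.
  by rewrite ger0_norm//; case/andP: (fb w).
have Va0 w : (0 <= Va w)%E by case: hVa.
apply: integ_of_le.
- exact: measurable_funM.
- by move=> w; rewrite mulr_ge0// powR_ge0.
- under eq_integral do rewrite EFinM.
  rewrite (condexp_ge0_pull_out _ _ hVa)//; last 2 first.
  + exact/measurable_EFinP.
  + by move=> w; rewrite lee_fin powR_ge0.
  rewrite EFinM -EFin_Rint//.
  (* The sign of [K] is known only from a point where [f] is nonzero, [Va] being nonnegative. If [f]
     vanishes identically, both sides are 0. *)
  have [[w fw0]|f_eq0] := pselect (exists w, f w != 0); last first.
    have fz w : f w = 0
      by apply: contrapT => /eqP fw; apply: f_eq0; exists w.
    rewrite (@eq_integral _ _ _ _ _ (cst 0%E)) => [|w _]; last by rewrite fz mul0e.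
    rewrite integral0 (@eq_integral _ _ _ _ _ (cst 0%E)) => [|w _]; last by rewrite fz.
    by rewrite integral0 mule0.
  have K0 : (0 <= K%:E)%E by apply: (le_trans (Va0 w)); exact: fVa.
  rewrite -ge0_integralZl//.
  + apply: ge0_le_integral => //.
    * by move=> x _; rewrite mule_ge0// lee_fin.
    * by apply: emeasurable_funM => //; exact/measurable_EFinP.
    * by apply: measurable_funeM; exact/measurable_EFinP.
    * move=> x _; have [->|fx] := eqVneq (f x) 0; first by rewrite mul0e mule0.
      by rewrite muleC lee_wpmul2r ?lee_fin// fVa.
  + exact/measurable_EFinP.
  + by move=> x _; rewrite lee_fin.
Qed.

(** [D] need not belong to [G], so its indicator cannot be pulled out. The bounded part [Lam] keeps
    this indicator, while the moment of order [a] is integrated without it, at the price of the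
    factor [theta]. *)
Lemma moment_2_le (f : T -> R) (K b theta Lam : R) :
  (forall x, 0 <= x -> x ^+ 2 <= Lam + theta * x `^ a) -> 0 <= theta ->
  measurable_wrt G f ->
  (forall w, 0 <= f w <= b) -> (forall w, f w != 0 -> (Va w <= K%:E)%E) ->
  forall D : set T, measurable D ->
  integ (fun w => f w * nrm (e w) ^+ 2 * \1_D w) /\
  \int[P]_w (f w * nrm (e w) ^+ 2 * \1_D w) <=
    Lam * \int[P]_w (f w * \1_D w) + theta * (K * \int[P]_w f w).
Proof.
move=> hLam t0 mf fb fVa D mD.
have [fi fle] := moment_a_le mf fb fVa.
have f0 w : 0 <= f w by have /andP[] := fb w.
have mfT : measurable_fun setT f by exact: measurable_wrtT mf.
have m1D : measurable_fun setT (\1_D : T -> R) by [].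
have ind01 w : 0 <= (\1_D w : R) <= 1.
  by rewrite indicE; case: (w \in D); rewrite ?lexx ?ler01.
have f1i : integ (fun w => f w * \1_D w).
  apply: (@integ_bounded _ _ _ P _ b); first exact: measurable_funM.
  move=> w; case/andP: (fb w) => fw0 fwb; rewrite normrM (ger0_norm fw0) indicE.
  by case: (w \in D); rewrite ?normr1 ?normr0 ?mulr1 ?mulr0//; exact: le_trans fwb.
have ri : integ (fun w => Lam * (f w * \1_D w) +
    theta * (f w * nrm (e w) `^ a)).
  by apply: integ_add; exact: integ_scale.
have le w : f w * nrm (e w) ^+ 2 * \1_D w <=
    Lam * (f w * \1_D w) + theta * (f w * nrm (e w) `^ a).
  have h := hLam _ (dot_norm_ge0 dot (e w)).
  have p0 := powR_ge0 (nrm (e w)) a.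
  have fp0 := mulr_ge0 t0 (mulr_ge0 (f0 w) p0).
  rewrite indicE; case: (w \in D) => /=; rewrite ?mulr1 ?mulr0 ?add0r//.
  have := ler_wpM2l (f0 w) h; rewrite mulrDr; lra.
have li : integ (fun w => f w * nrm (e w) ^+ 2 * \1_D w).
  apply: integ_le ri.
    apply: measurable_funM => //; apply: measurable_funM => //.
    exact: measurable_funX.
  move=> w; rewrite ger0_norm//; apply: mulr_ge0; last by case/andP: (ind01 w).
  by apply: mulr_ge0 => //; exact: sqr_ge0.
split=> //; apply: le_trans (le_Rint li ri le) _.
rewrite RintegralD//; try exact: integ_scale.
by rewrite !RintegralZl// lerD2l ler_wpM2l.
Qed.

Lemma moment_2_ge (f : T -> R) (v : R) : measurable_wrt G f ->
  (forall w, 0 <= f w) -> (forall w, f w != 0 -> (v%:E <= V2 w)%E) -> 0 <= v ->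
  integ f -> integ (fun w => f w * nrm (e w) ^+ 2) ->
  v * \int[P]_w f w <= \int[P]_w (f w * nrm (e w) ^+ 2).
Proof.
move=> mf f0 fV2 v0 fi fei.
have mfT : measurable_fun setT f by exact: measurable_wrtT mf.
have mV2 : measurable_fun setT V2 by case: hV2 => m _ _; exact: measurable_wrtT m.
have V20 w : (0 <= V2 w)%E by case: hV2.
rewrite -lee_fin EFinM -!EFin_Rint//.
under [leRHS]eq_integral do rewrite EFinM.
rewrite (condexp_ge0_pull_out _ _ hV2)//; last 2 first.
- by apply/measurable_EFinP; exact: measurable_funX.
- by move=> w; rewrite lee_fin sqr_ge0.
rewrite -ge0_integralZl//; last 2 first.
- exact/measurable_EFinP.
- by move=> w _; rewrite lee_fin.
apply: ge0_le_integral => //.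
- by move=> x _; rewrite mule_ge0// lee_fin.
- by apply: measurable_funeM; exact/measurable_EFinP.
- by apply: emeasurable_funM => //; exact/measurable_EFinP.
- move=> x _; have [->|fx] := eqVneq (f x) 0; first by rewrite mul0e mule0.
  by rewrite muleC lee_wpmul2l ?lee_fin// fV2.
Qed.

End Moments.

Section Centered.
Hypothesis he : condexp_vec P G e (fun=> 0).

(** Only the product of [f] and the coordinate is assumed integrable. The positive and negative
    parts of the coordinate have almost surely the same conditional expectation, so they agree
    against every nonnegative [G]-measurable weight; splitting [f] as well leaves four integrable
    products that cancel. *)
Lemma centered_coord (f : T -> R) i : measurable_wrt G f ->
  integ (fun w => f w * e w ord0 i) -> \int[P]_w (f w * e w ord0 i) = 0.
Proof.
move=> mf fi.
have mfT : measurable_fun setT f by exact: measurable_wrtT mf.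
have [_ [Zp [Zm [hp hm aeZ]]]] := he i.
have mY : measurable_fun setT (fun w => (e w ord0 i)%:E).
  by apply/measurable_EFinP; exact: me.
have mZp : measurable_fun setT Zp by case: hp => m _ _; exact: measurable_wrtT m.
have mZm : measurable_fun setT Zm by case: hm => m _ _; exact: measurable_wrtT m.
have Zp0 w : (0 <= Zp w)%E by case: hp.
have Zm0 w : (0 <= Zm w)%E by case: hm.
pose ep w := Num.max (e w ord0 i) 0; pose en w := Num.max (- e w ord0 i) 0.
have epE w : ((fun w => (e w ord0 i)%:E)^\+ w = (ep w)%:E)%E.
  by rewrite funeposE -EFin_max.
have enE w : ((fun w => (e w ord0 i)%:E)^\- w = (en w)%:E)%E.
  by rewrite funenegE -EFinN -EFin_max.
have mep : measurable_fun setT ep by apply: measurable_maxr => //; exact: me.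
have men : measurable_fun setT en.
  by apply: measurable_maxr => //; apply: measurableT_comp => //; exact: me.
have ep_en (g : T -> R) : measurable_wrt G g -> (forall w, 0 <= g w) ->
    \int[P]_w (g w * ep w) = \int[P]_w (g w * en w).
  move=> mg g0; rewrite /Rintegral; congr fine.
  under eq_integral do rewrite EFinM -epE.
  under [RHS]eq_integral do rewrite EFinM -enE.
  rewrite (condexp_ge0_pull_out _ _ hp)//; last exact: measurable_funepos.
  rewrite (condexp_ge0_pull_out _ _ hm)//; last exact: measurable_funeneg.
  have mgT : measurable_fun setT (EFin \o g).
    by apply/measurable_EFinP; exact: measurable_wrtT mg.
  apply: ge0_ae_eq_integral => //.
  - exact: emeasurable_funM.
  - exact: emeasurable_funM.
  - by move=> w _; rewrite mule_ge0// lee_fin.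
  - by move=> w _; rewrite mule_ge0// lee_fin.
  - apply: filterS aeZ => w [def eZ] _; congr (_ * _)%E.
    (* A well-defined difference equal to 0 excludes infinite values, hence [Zp w = Zm w]. *)
    move: (Zp0 w) (Zm0 w) def eZ; case: (Zp w) => [x| |]; case: (Zm w) => [y| |]//.
    by move=> _ _ _; rewrite mxE -EFinB => -[/esym/subr0_eq ->].
pose fp w := Num.max (f w) 0; pose fn w := Num.max (- f w) 0.
have mfp : measurable_wrt G fp.
  by apply: (@measurable_maxr _ (g_sigma_algebraType G)) => //; exact: measurable_cst.
have mfn : measurable_wrt G fn.
  apply: (@measurable_maxr _ (g_sigma_algebraType G)) => //.
  by apply: measurableT_comp => //.
have mx0 (x : R) : 0 <= Num.max x 0 by rewrite le_max lexx orbT.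
have dom (g h : T -> R) : measurable_wrt G g -> measurable_fun setT h ->
    (forall w, `|g w| <= `|f w|) -> (forall w, `|h w| <= `|e w ord0 i|) ->
    integ (fun w => g w * h w).
  move=> mg mh gf hw; apply: (@integ_le _ _ _ _ _ (fun w => `|f w * e w ord0 i|)).
  - by apply: measurable_funM => //; exact: measurable_wrtT mg.
  - by move=> w; rewrite !normrM ler_pM.
  - exact: integrable_norm.
have maxn (x : R) : `|Num.max x 0| <= `|x|.
  by rewrite ger0_norm ?mx0// ge_max ler_norm normr_ge0.
have maxN (x : R) : `|Num.max (- x) 0| <= `|x| by rewrite -(normrN x) maxn.
have pp : integ (fun w => fp w * ep w) by apply: dom => // w; rewrite ?maxn ?maxN.
have pn : integ (fun w => fp w * en w) by apply: dom => // w; rewrite ?maxn ?maxN.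
have np : integ (fun w => fn w * ep w) by apply: dom => // w; rewrite ?maxn ?maxN.
have nn : integ (fun w => fn w * en w) by apply: dom => // w; rewrite ?maxn ?maxN.
have maxE (x : R) : x = Num.max x 0 - Num.max (- x) 0.
  by rewrite /Num.max oppr_lt0; case: ltgtP => x0; lra.
transitivity (\int[P]_w ((fp w * ep w - fp w * en w) -
    (fn w * ep w - fn w * en w))).
  apply: eq_Rintegral => w _; rewrite {1}(maxE (f w)) {1}(maxE (e w ord0 i)).
  by rewrite -/(fp w) -/(fn w) -/(ep w) -/(en w); ring.
rewrite RintegralB//; [|exact: (integrableB measurableT pp pn)|
  exact: (integrableB measurableT np nn)].
rewrite !RintegralB// !ep_en ?subrr//.
- by move=> w; exact: mx0.
- by move=> w; exact: mx0.
Qed.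

End Centered.
End NoiseStep.

(** * Martingales *)

Section MartingaleIncrement.
Variables (R : realType) (d : nat) (dot : {dot 'rV[R]_d for idfun}).
Variables (disp : measure_display) (T : measurableType disp).
Variables (P : probability T R) (G : set (set T)).
Hypotheses (sG : sigma_algebra setT G) (subG : G `<=` measurable).
Variables (e u : T -> 'rV[R]_d).
Hypothesis me : forall i, measurable_fun setT (fun w => e w ord0 i).
Hypothesis mu : forall i, measurable_wrt G (fun w => u w ord0 i).
Local Notation nrm := (dot_norm dot).
Local Notation integ f := (P.-integrable setT (EFin \o f)).
Variables (a K K1 b : R) (Va : T -> \bar R).
Hypothesis hVa : condexp_ge0 P G (fun w => (nrm (e w) `^ a)%:E) Va.
Hypothesis hK1 : forall x, 0 <= x -> x ^+ 2 <= K1 + 1 * x `^ a.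
Hypothesis ub : forall w, nrm (u w) <= b.
Hypothesis uVa : forall w, u w != 0 -> (Va w <= K%:E)%E.

Let muT i : measurable_fun setT (fun w => u w ord0 i).
Proof. exact: measurable_wrtT (mu i). Qed.

Let mnu : measurable_wrt G (fun w => nrm (u w)).
Proof. exact: (@measurable_dot_norm _ _ _ _ (g_sigma_algebraType G)). Qed.

(** This is [moment_2_le] over the whole space with [theta = 1] and the weight [nrm (u w) ^+ 2],
    which vanishes wherever [u] does. *)
Lemma increment_norm_sq :
  sq_integ P (fun w => nrm (u w) * nrm (e w)) /\
  \int[P]_w ((nrm (u w) * nrm (e w)) ^+ 2) <=
    (K1 + K) * \int[P]_w (nrm (u w) ^+ 2).
Proof.
have [] := @moment_2_le R d dot disp T P G sG subG e me a Va hVa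
  (fun w => nrm (u w) ^+ 2) K (b ^+ 2) 1 K1 hK1 ler01 _ _ _ setT measurableT.
- exact: (@measurable_funX _ (g_sigma_algebraType G)).
- move=> w; rewrite sqr_ge0/= lerXn2r// nnegrE ?dot_norm_ge0//.
  exact: le_trans (dot_norm_ge0 dot (u w)) (ub w).
- move=> w; rewrite expf_eq0/= => nu; apply: uVa; apply: contraNneq nu => ->.
  by rewrite dot_norm0.
have E w : nrm (u w) ^+ 2 * nrm (e w) ^+ 2 * \1_setT w =
    (nrm (u w) * nrm (e w)) ^+ 2.
  by rewrite indicT mulr1 exprMn.
move=> int le; split; first split.
- apply: measurable_funM; apply: measurable_dot_norm => //.
- by apply: eq_integrable int => // w _ /=; rewrite E.
- under eq_Rintegral do rewrite -E.
  apply: le_trans le _; rewrite mul1r mulrDl lerD2r.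
  by under eq_Rintegral do rewrite indicT mulr1.
Qed.

Lemma increment_sq :
  sq_integ P (fun w => dot (u w) (e w)) /\
  \int[P]_w (dot (u w) (e w) ^+ 2) <= (K1 + K) * \int[P]_w (nrm (u w) ^+ 2).
Proof.
have [sq le] := increment_norm_sq.
have sqd : sq_integ P (fun w => dot (u w) (e w)).
  apply: sq_integ_le sq; first exact: measurable_dot.
  move=> w; rewrite (le_trans (normr_dot_le _ _ _))// ler_norm//.
split => //; apply: le_trans le; apply: le_Rint.
- by case: sqd.
- by case: sq.
- move=> w; rewrite -real_normK ?num_real// lerXn2r ?nnegrE//.
    by rewrite mulr_ge0// dot_norm_ge0.
  exact: normr_dot_le.
Qed.

(** Centering is known coordinatewise, so [e] is expanded in the canonical basis; each term is
    integrable because a coordinate is at most a multiple of the norm. *)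
Lemma increment_orth (Y : T -> R) : condexp_vec P G e (fun=> 0) ->
  measurable_wrt G Y -> sq_integ P Y ->
  \int[P]_w (Y w * dot (u w) (e w)) = 0.
Proof.
move=> he mY Y2; have [sq _] := increment_norm_sq.
have [C C0 hC] := coord_le_dot_norm dot.
have Yi := sq_integ_mul Y2 sq.
pose f i w := Y w * dot (u w) 'e_i.
have mf i : measurable_wrt G (f i).
  apply: (@measurable_funM _ (g_sigma_algebraType G)) => //.
  by apply: (@measurable_dot _ _ _ _ (g_sigma_algebraType G)).
have fe i : integ (fun w => f i w * e w ord0 i).
  apply: (@integ_le _ _ _ _ _ (fun w => C * nrm 'e_i *
      `|Y w * (nrm (u w) * nrm (e w))|)).
  - by apply: measurable_funM => //; exact: measurable_wrtT (mf i).
  - move=> w; rewrite /f !normrM (ger0_norm (dot_norm_ge0 dot (u w))).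
    rewrite (ger0_norm (dot_norm_ge0 dot (e w))).
    have -> : C * nrm 'e_i * (`|Y w| * (nrm (u w) * nrm (e w))) =
      `|Y w| * (nrm (u w) * nrm 'e_i) * (C * nrm (e w)) by ring.
    by apply: ler_pM => //; rewrite ler_wpM2l// normr_dot_le.
  - by apply: integ_scale; exact: integrable_norm.
have E w : Y w * dot (u w) (e w) = \sum_i f i w * e w ord0 i.
  rewrite {1}(row_sum_delta (e w)) linear_sum/= mulr_sumr; apply: eq_bigr => i _.
  by rewrite /f dotZr; ring.
under eq_Rintegral do rewrite E.
rewrite /Rintegral; under eq_integral do rewrite -sumEFin.
rewrite integral_sum//= ?big1// => i _.
by rewrite EFin_Rint// (centered_coord sG subG me he).
Qed.

End MartingaleIncrement.

Section Martingale.
Variables (R : realType) (d : nat) (dot : {dot 'rV[R]_d for idfun}).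
Variables (disp : measure_display) (T : measurableType disp).
Variables (P : probability T R) (F : nat -> set (set T)).
Hypothesis hF : filtration F.
Variables (eps u : nat -> T -> 'rV[R]_d).
Local Notation nrm := (dot_norm dot).
Local Notation integ f := (P.-integrable setT (EFin \o f)).
Hypothesis heps : adapted F eps.
Hypothesis eps_centered : forall n, condexp_vec P (F n) (eps n.+1) (fun=> 0).
Variables (a K K1 : R) (b : nat -> R) (Va : nat -> T -> \bar R).
Hypothesis hVa : forall n,
  condexp_ge0 P (F n) (fun w => (nrm (eps n.+1 w) `^ a)%:E) (Va n).
Hypothesis hK1 : forall x, 0 <= x -> x ^+ 2 <= K1 + 1 * x `^ a.
Hypothesis mu : adapted F u.
Hypothesis ub : forall n w, nrm (u n w) <= b n.
Hypothesis uVa : forall n w, u n w != 0 -> (Va n w <= K%:E)%E.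

Let sF n : sigma_algebra setT (F n). Proof. by case: hF. Qed.
Let subF n : F n `<=` measurable. Proof. by case: hF. Qed.
Let FF m n : (m <= n)%N -> F m `<=` F n. Proof. by case: hF => _ _; exact. Qed.
Let mepsT n i : measurable_fun setT (fun w => eps n w ord0 i).
Proof. exact: measurable_wrtT (@heps n i). Qed.

(** A martingale transform of the noise: [u j] is known at time [j], before [eps j.+1]. *)
Definition mart k l w := \sum_(k <= j < l) dot (u j w) (eps j.+1 w).

Lemma measurable_mart k l : measurable_wrt (F l) (mart k l).
Proof.
elim: l => [|l ih].
  rewrite /mart; under eq_fun do rewrite big_geq//.
  exact: measurable_cst.
have [kl|lk] := leqP k l; last first.
  rewrite /mart; under eq_fun do rewrite big_geq//.
  exact: measurable_cst.
rewrite /mart; under eq_fun do rewrite big_nat_recr//=.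
apply: (@measurable_funD _ (g_sigma_algebraType (F l.+1))).
  by apply: measurable_wrtS ih => //; exact: FF.
apply: (@measurable_dot _ _ _ _ (g_sigma_algebraType (F l.+1))) => i.
  by apply: measurable_wrtS (@mu l i) => //; exact: FF.
exact: heps.
Qed.

(** Induction on [l]: the new increment is orthogonal to the martingale so far, so variances add,
    and to the constant 1, so the mean stays 0. *)
Lemma mart_sq k l :
  [/\ sq_integ P (mart k l), \int[P]_w mart k l w = 0 &
   \int[P]_w (mart k l w ^+ 2) <=
     (K1 + K) * \sum_(k <= j < l) \int[P]_w (nrm (u j w) ^+ 2)].
Proof.
have base l' : (l' <= k)%N -> [/\ sq_integ P (mart k l'),
    \int[P]_w mart k l' w = 0 & \int[P]_w (mart k l' w ^+ 2) <=
     (K1 + K) * \sum_(k <= j < l') \int[P]_w (nrm (u j w) ^+ 2)].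
  move=> lk; have m0 : mart k l' = cst 0.
    by apply/funext => w; rewrite /mart big_geq.
  rewrite m0; split.
  - split; first exact: measurable_cst.
    apply: (@integ_bounded _ _ _ _ _ 0) => [|w]; last by rewrite expr0n normr0.
    exact: measurable_funX.
  - by rewrite Rintegral_cst// mul0r.
  - under eq_Rintegral do rewrite expr0n/=.
    by rewrite Rintegral_cst// mul0r big_geq// mulr0.
elim: l => [|l [sqM M0 M2]]; first exact: base.
have [kl|lk] := leqP k l; last exact: base.
have [sqd d2] := increment_sq (sF l) (@subF l) (@mepsT l.+1) (@mu l) (hVa l) hK1
  (ub l) (@uVa l).
have orth Y := increment_orth (sF l) (@subF l) (@mepsT l.+1) (@mu l) (hVa l) hK1
  (ub l) (@uVa l) (eps_centered l) (Y := Y).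
have E w : mart k l.+1 w = mart k l w + dot (u l w) (eps l.+1 w).
  by rewrite /mart big_nat_recr.
have -> : mart k l.+1 = fun w => mart k l w + dot (u l w) (eps l.+1 w).
  exact/funext.
split.
- exact: sq_integ_add.
- rewrite RintegralD//; try exact: sq_integ_integ.
  rewrite M0 add0r; have /= := orth (cst 1); under eq_Rintegral do rewrite mul1r.
  apply; first exact: measurable_cst.
  split; first exact: measurable_cst.
  apply: (@integ_bounded _ _ _ _ _ 1) => [|w]; last by rewrite expr1n normr1.
  exact: measurable_funX.
- have sqE w : (mart k l w + dot (u l w) (eps l.+1 w)) ^+ 2 =
      (mart k l w ^+ 2 + dot (u l w) (eps l.+1 w) ^+ 2) +
      2 * (mart k l w * dot (u l w) (eps l.+1 w)) by ring.
  under eq_Rintegral do rewrite sqE.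
  have i1 := sq_integ_mul sqM sqd.
  case: (sqM) => _ i2; case: (sqd) => _ i3.
  rewrite RintegralD//; [|exact: integ_add|exact: integ_scale].
  rewrite RintegralD// RintegralZl// (orth _ (@measurable_mart k l) sqM).
  by rewrite mulr0 addr0 big_nat_recr//= mulrDr lerD.
Qed.

End Martingale.

(** * Pathwise estimates *)

Section Pathwise.
Variables (R : realType) (d : nat) (dot : {dot 'rV[R]_d for idfun}).
Local Notation nrm := (dot_norm dot).
Variables (c : nat -> R) (x y e r : nat -> 'rV[R]_d) (n m : nat) (sigma eta : R).
Hypotheses (sigma_gt0 : 0 < sigma) (eta_gt0 : 0 < eta).
Hypothesis c2 : \sum_(n <= k < m) c k.+1 ^+ 2 = sigma ^+ 2.
Hypothesis r2 : \sum_(n <= k < m) nrm (r k.+1) ^+ 2 <= eta ^+ 2.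
Hypothesis xm : nrm (x m) <= eta * sigma.
Hypothesis xS : forall k, (n <= k < m)%N ->
  x k.+1 = y k + c k.+1 *: (e k.+1 + r k.+1).
Hypothesis xy : forall k, (n <= k < m)%N -> nrm (x k) <= nrm (y k).

(** At 0 the inverse of the norm is 0, so the direction is 0 and the next two lemmas hold without
    exception. *)
Definition unit_vec (u : 'rV[R]_d) : 'rV[R]_d := (nrm u)^-1 *: u.

Lemma dot_unit_vec u : dot (unit_vec u) u = nrm u.
Proof.
rewrite /unit_vec dotZl -sqr_dot_norm.
have [->|u0] := eqVneq (nrm u) 0; first by rewrite expr0n mulr0.
by rewrite expr2 mulKf.
Qed.

Lemma unit_vec_le1 u : nrm (unit_vec u) <= 1.
Proof.
rewrite /unit_vec dot_normZ normfV ger0_norm ?dot_norm_ge0//.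
have [->|u0] := eqVneq (nrm u) 0; first by rewrite mulr0.
by rewrite mulVf.
Qed.

Let sum_sub (f : nat -> R) k l : (n <= k)%N -> (l <= m)%N -> (forall j, 0 <= f j) ->
  \sum_(k <= j < l) f j <= \sum_(n <= j < m) f j.
Proof.
move=> nk lm f0; have [kl|lk] := leqP k l; last first.
  by rewrite big_geq ?sumr_ge0// ltnW.
rewrite (big_cat_nat (leq_trans nk kl) lm)/= (big_cat_nat nk kl)/=.
have h1 : 0 <= \sum_(n <= j < k) f j by exact: sumr_ge0.
have h2 : 0 <= \sum_(l <= j < m) f j by exact: sumr_ge0.
lra.
Qed.

Lemma drift_le k l : (n <= k)%N -> (l <= m)%N ->
  \sum_(k <= j < l) (`|c j.+1| * nrm (r j.+1)) <= eta * sigma.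
Proof.
move=> nk lm; apply: le_trans (sum_sub nk lm _) _.
  by move=> j; rewrite mulr_ge0// dot_norm_ge0.
(* AM-GM with weights making both sums equal to [eta * sigma] *)
apply: (@le_trans _ _ (\sum_(n <= j < m)
    (eta / sigma / 2 * c j.+1 ^+ 2 + sigma / eta / 2 * nrm (r j.+1) ^+ 2))).
  apply: ler_sum_nat => j _; rewrite -(real_normK (num_real (c j.+1))).
  set p := `|_|; set q := nrm _; rewrite -subr_ge0.
  have -> : eta / sigma / 2 * p ^+ 2 + sigma / eta / 2 * q ^+ 2 - p * q =
      (eta * p - sigma * q) ^+ 2 / (2 * sigma * eta).
    by field; rewrite !gt_eqF.
  by rewrite divr_ge0 ?sqr_ge0// !mulr_ge0 ?ltW.
rewrite big_split/= -!mulr_sumr c2.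
have -> : eta / sigma / 2 * sigma ^+ 2 = eta * sigma / 2.
  by field; rewrite gt_eqF.
have : sigma / eta / 2 * \sum_(n <= i < m) nrm (r i.+1) ^+ 2 <=
    sigma / eta / 2 * eta ^+ 2.
  by rewrite ler_wpM2l// !divr_ge0 ?ltW.
have -> : sigma / eta / 2 * eta ^+ 2 = eta * sigma / 2.
  by field; rewrite gt_eqF.
lra.
Qed.

(* Convexity of the norm: pairing [x j.+1] with the unit vector along [y j]. *)
Lemma norm_le_mart k : (n <= k < m)%N ->
  nrm (y k) <= - \sum_(k <= j < m) dot (c j.+1 *: unit_vec (y j)) (e j.+1)
    + 2 * eta * sigma.
Proof.
move=> /andP[nk km].
have step j : (n <= j < m)%N -> nrm (y j) +
    dot (c j.+1 *: unit_vec (y j)) (e j.+1) - `|c j.+1| * nrm (r j.+1) <=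
    nrm (x j.+1).
  move=> jnm; apply: le_trans (_ : dot (unit_vec (y j)) (x j.+1) <= _); last first.
    apply: le_trans (dot_le _ _ _) _.
    by rewrite ler_piMl ?dot_norm_ge0 ?unit_vec_le1.
  rewrite xS// dotDr dot_unit_vec dotZr dotDr dotZl mulrDr -addrA lerD2l lerD2l.
  rewrite lerNl -mulrN (le_trans (ler_norm _))// normrM ler_wpM2l// normrN.
  apply: le_trans (normr_dot_le _ _ _) _.
  by rewrite ler_piMl ?dot_norm_ge0 ?unit_vec_le1.
(* The steps chain because [nrm (x l) <= nrm (y l)]. *)
have H l : (k < l <= m)%N -> nrm (y k) +
    \sum_(k <= j < l) dot (c j.+1 *: unit_vec (y j)) (e j.+1) -
    \sum_(k <= j < l) (`|c j.+1| * nrm (r j.+1)) <= nrm (x l).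
  elim: l => [//|l ih] /andP[kl lm]; have := step l; rewrite lm andbT.
  move=> /(_ (leq_trans nk kl)); rewrite !big_nat_recr//=.
  move: kl; rewrite ltnS leq_eqVlt => /predU1P[kl|kl].
    by rewrite -kl !big_geq// !add0r.
  move: ih; rewrite kl (ltnW lm) => /(_ isT) ih.
  have := xy (k := l); rewrite lm (leq_trans nk (ltnW kl)) => /(_ isT).
  lra.
have := H m; rewrite km leqnn => /(_ isT).
have := drift_le nk (leqnn m); have := xm.
lra.
Qed.

(** The expansion of [nrm (x k.+1) ^+ 2] telescopes, and its initial value is dropped. On the right,
    [2 * L * eta] pays for the pairing of [y] with [r], by [drift_le]; one [eta ^+ 2] pays for
    [nrm (x m) ^+ 2], the other for the squares of [r]. *)
Lemma sqr_norm_ge (L : R) : (forall k, (n <= k < m)%N -> nrm (y k) <= L * sigma) ->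
  \sum_(n <= k < m) dot ((2 * c k.+1) *: y k) (e k.+1) +
    2^-1 * \sum_(n <= k < m) c k.+1 ^+ 2 * nrm (e k.+1) ^+ 2 <=
  (2 * L * eta + 2 * eta ^+ 2) * sigma ^+ 2.
Proof.
move=> yL.
have step k : (n <= k < m)%N -> nrm (x k) ^+ 2 +
    dot ((2 * c k.+1) *: y k) (e k.+1) + 2^-1 * (c k.+1 ^+ 2 * nrm (e k.+1) ^+ 2)
    - 2 * L * sigma * (`|c k.+1| * nrm (r k.+1)) -
      sigma ^+ 2 * nrm (r k.+1) ^+ 2 <= nrm (x k.+1) ^+ 2.
  move=> knm; have xk : nrm (x k) ^+ 2 <= nrm (y k) ^+ 2.
    by rewrite lerXn2r ?nnegrE ?dot_norm_ge0// xy.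
  have ck : c k.+1 ^+ 2 * nrm (r k.+1) ^+ 2 <= sigma ^+ 2 * nrm (r k.+1) ^+ 2.
    rewrite ler_wpM2r ?sqr_ge0// -c2.
    case/andP: knm => nk km.
    have := @sum_sub (fun j => c j.+1 ^+ 2) k k.+1 nk km (fun j => sqr_ge0 _).
    by rewrite big_nat1.
  have yr : - (2 * L * sigma * (`|c k.+1| * nrm (r k.+1))) <=
      2 * c k.+1 * dot (y k) (r k.+1).
    rewrite lerNl -mulrN (le_trans (ler_norm _))// !normrM normrN.
    rewrite (@ger0_norm _ 2)//.
    have := normr_dot_le dot (y k) (r k.+1); have := yL k knm.
    move=> h1 h2; have h3 : nrm (y k) * nrm (r k.+1) <= L * sigma * nrm (r k.+1).
      by rewrite ler_wpM2r ?dot_norm_ge0.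
    have := ler_wpM2l (normr_ge0 (c k.+1)) (le_trans h2 h3).
    lra.
  (* This positivity yields [|e + r|^2 >= |e|^2 / 2 - |r|^2], whence the factor [2^-1] in front of
     the squared noise. *)
  have er : 0 <= nrm (e k.+1 + 2%:R *: r k.+1) ^+ 2 by exact: sqr_ge0.
  have ecr := mulr_ge0 (sqr_ge0 (c k.+1)) er.
  rewrite [leRHS]sqr_dot_norm xS//; move: ecr.
  rewrite !sqr_dot_norm !(dotDl, dotDr, dotZl, dotZr) in xk ck *.
  rewrite (dotC dot (r k.+1) (e k.+1)) (dotC dot (e k.+1) (y k)).
  rewrite (dotC dot (r k.+1) (y k)).
  move: yr ck xk; lra.
have H l : (n <= l <= m)%N ->
    \sum_(n <= k < l) dot ((2 * c k.+1) *: y k) (e k.+1) +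
    2^-1 * (\sum_(n <= k < l) c k.+1 ^+ 2 * nrm (e k.+1) ^+ 2) -
    2 * L * sigma * (\sum_(n <= k < l) (`|c k.+1| * nrm (r k.+1))) -
    sigma ^+ 2 * (\sum_(n <= k < l) nrm (r k.+1) ^+ 2) <= nrm (x l) ^+ 2.
  elim: l => [|l ih] /andP[nl lm].
    by rewrite !big_geq// !mulr0 !subr0 add0r sqr_ge0.
  move: nl; rewrite leq_eqVlt => /predU1P[->|nl].
    by rewrite !big_geq// !mulr0 !subr0 add0r sqr_ge0.
  rewrite !big_nat_recr//=; have := step l; rewrite lm andbT => /(_ nl).
  move: ih; rewrite (ltnW lm) andbT => /(_ nl).
  lra.
(* An empty range would make [sigma] zero; a nonempty one forces [0 <= L]. *)
have [mn|nm] := leqP m n.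
  move: c2; rewrite big_geq// => /esym/eqP; rewrite expf_eq0/=.
  by rewrite gt_eqF.
have := H m; rewrite leqnn (ltnW nm) => /(_ isT).
have L0 : 0 <= L.
  have := yL n; rewrite leqnn nm => /(_ isT)/(le_trans (dot_norm_ge0 dot _)).
  by rewrite pmulr_lge0.
have := ler_wpM2l (mulr_ge0 (mulr_ge0 (ler0n R 2) L0) (ltW sigma_gt0))
  (drift_le (leqnn n) (leqnn m)).
have := ler_wpM2l (sqr_ge0 sigma) r2.
have xm2 : nrm (x m) ^+ 2 <= (eta * sigma) ^+ 2.
  by rewrite lerXn2r// nnegrE ?dot_norm_ge0// mulr_ge0// ltW.
move: xm2; lra.
Qed.

End Pathwise.

(** * The process on a finite horizon *)

Section Probability.
Variables (disp : measure_display) (T : measurableType disp) (R : realType).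
Variable P : probability T R.
Local Notation pr A := (fine (P A)).

Lemma pr_setID (A C : set T) : measurable A -> measurable C ->
  pr A = pr (A `&` C) + pr (A `\` C).
Proof.
move=> mA mC; rewrite -fineD ?fin_num_measure//; last 2 first.
- exact: measurableI.
- exact: measurableD.
by rewrite addeC -measureDI.
Qed.

Lemma pr_le (A C : set T) : measurable A -> measurable C -> A `<=` C ->
  pr A <= pr C.
Proof.
by move=> mA mC AC; rewrite fine_le ?fin_num_measure// le_measure ?inE.
Qed.

Lemma pr_ge0 (A : set T) : 0 <= pr A.
Proof. exact: fine_ge0. Qed.

End Probability.

Section Horizon.
Variables (R : realType) (d : nat) (dot : {dot 'rV[R]_d for idfun}).
Variables (disp : measure_display) (T : measurableType disp).
Variables (P : probability T R) (F : nat -> set (set T)).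
Hypothesis hF : filtration F.
Variables (c : nat -> R) (X W eps r : nat -> T -> 'rV[R]_d).
Local Notation nrm := (dot_norm dot).
Local Notation integ f := (P.-integrable setT (EFin \o f)).
Local Notation pr A := (fine (P A)).
Hypotheses (hW : adapted F W) (heps : adapted F eps).
Hypothesis eps_centered : forall n, condexp_vec P (F n) (eps n.+1) (fun=> 0).
Variables (a v K K1 theta Lam : R) (V2 Va : nat -> T -> \bar R).
Hypothesis hV2 : forall n,
  condexp_ge0 P (F n) (fun w => (nrm (eps n.+1 w) ^+ 2)%:E) (V2 n).
Hypothesis hVa : forall n,
  condexp_ge0 P (F n) (fun w => (nrm (eps n.+1 w) `^ a)%:E) (Va n).
Hypothesis hK1 : forall x, 0 <= x -> x ^+ 2 <= K1 + 1 * x `^ a.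
Hypothesis hLam : forall x, 0 <= x -> x ^+ 2 <= Lam + theta * x `^ a.
Hypotheses (v_ge0 : 0 <= v) (K_ge0 : 0 <= K) (K1_ge0 : 0 <= K1).
Hypothesis theta_ge0 : 0 <= theta.

Definition moments_ok k : set T :=
  [set w | (v%:E <= V2 k w)%E /\ (Va k w <= K%:E)%E].

Variables (n m : nat) (B D : set T) (sigma eta L : R).
Hypotheses (sigma_gt0 : 0 < sigma) (eta_gt0 : 0 < eta) (L_eta : 2 * eta < L).
Hypothesis c2 : \sum_(n <= k < m) c k.+1 ^+ 2 = sigma ^+ 2.
Hypotheses (FB : F n B) (mD : measurable D) (DB : D `<=` B).
Hypothesis D_ok : forall w, D w -> forall k, (n <= k < m)%N ->
  [/\ moments_ok k w, nrm (X k w) <= nrm (W k w) &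
   X k.+1 w = W k w + c k.+1 *: (eps k.+1 w + r k.+1 w)].
Hypothesis D_r : forall w, D w ->
  \sum_(n <= k < m) nrm (r k.+1 w) ^+ 2 <= eta ^+ 2.
Hypothesis D_X : forall w, D w -> nrm (X m w) <= eta * sigma.

Let sF k : sigma_algebra setT (F k). Proof. by case: hF. Qed.
Let subF k : F k `<=` measurable. Proof. by case: hF. Qed.
Let FF j k : (j <= k)%N -> F j `<=` F k. Proof. by case: hF => _ _; exact. Qed.
Let mepsT k i : measurable_fun setT (fun w => eps k w ord0 i).
Proof. exact: measurable_wrtT (@heps k i). Qed.
Let mnW k : measurable_wrt (F k) (fun w => nrm (W k w)).
Proof.
by apply: (@measurable_dot_norm _ _ _ _ (g_sigma_algebraType (F k))) => i; exact: hW.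
Qed.
Let mT k (A : set T) : F k A -> measurable A. Proof. exact: subF. Qed.


Lemma F_moments_ok k : F k (moments_ok k).
Proof.
apply: (@eventI _ _ _ _ [set w | (v%:E <= V2 k w)%E] [set w | (Va k w <= K%:E)%E]) => //.
- by apply: event_lee => //; [exact: measurable_cst|case: (hV2 k)].
- by apply: event_lee => //; [case: (hVa k)|exact: measurable_cst].
Qed.

(** * Martingales gated by an event *)

Section Gate.
Variables (A : set T) (k : nat).
Hypothesis FA : F k A.

(** The path is controlled only on [D], which need not be known at intermediate times. The gate
    retains what is known at time [j]: multiplied by it, an integrand stays adapted and vanishes
    where the conditional moment is too large. *)
Definition gate j w : R :=
  if (k <= j)%N then \1_(A `&` moments_ok j) w else 0.

Lemma gateP j w :
  gate j w = 0 \/ [/\ gate j w = 1, (k <= j)%N, A w & moments_ok j w].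
Proof.
rewrite /gate; case: (leqP k j) => kj; last by left.
rewrite indicE; case: (boolP (w \in _)) => [|_]; last by left.
by rewrite inE => -[]; right.
Qed.

Lemma gate1 j w : (k <= j)%N -> A w -> moments_ok j w -> gate j w = 1.
Proof. by move=> kj Aw ok; rewrite /gate kj indicE mem_set. Qed.

Lemma measurable_gate j : measurable_wrt (F j) (gate j).
Proof.
rewrite /gate; case: (leqP k j) => kj; last exact: measurable_cst.
apply: measurable_wrt_indic => //; apply: eventI => //; last exact: F_moments_ok.
exact: (FF kj).
Qed.

Definition gated_dir j w : 'rV[R]_d := (gate j w * c j.+1) *: unit_vec dot (W j w).

Lemma adapted_gated_dir : adapted F gated_dir.
Proof.
move=> j i; rewrite /gated_dir /unit_vec; under eq_fun do rewrite !mxE.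
apply: (@measurable_funM _ (g_sigma_algebraType (F j))).
  apply: (@measurable_funM _ (g_sigma_algebraType (F j))).
    exact: measurable_gate.
  exact: measurable_cst.
apply: (@measurable_funM _ (g_sigma_algebraType (F j))); last exact: hW.
(* The inverse is replaced by the power -1, a measurable function that agrees with it on nonnegative
   reals, 0 included. *)
under eq_fun do rewrite -powR_inv1 ?dot_norm_ge0//.
exact: (measurableT_comp (measurable_powR (-1)) (@mnW j)).
Qed.

Lemma gated_dir_sq j w : nrm (gated_dir j w) ^+ 2 <= c j.+1 ^+ 2 * \1_A w.
Proof.
rewrite /gated_dir dot_normZ exprMn real_normK ?num_real// exprMn.
have u1 : nrm (unit_vec dot (W j w)) ^+ 2 <= 1.
  by rewrite expr_le1// ?dot_norm_ge0// unit_vec_le1.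
have [->|[-> _ Aw _]] := gateP j w.
  by rewrite expr0n/= !mul0r mulr_ge0 ?sqr_ge0.
by rewrite indicE mem_set// expr1n mul1r ler_wpM2l ?sqr_ge0.
Qed.

Lemma gated_dir_le j w : nrm (gated_dir j w) <= `|c j.+1|.
Proof.
rewrite -(@ler_pXn2r _ 2)// ?nnegrE ?dot_norm_ge0//.
apply: le_trans (gated_dir_sq j w) _.
by rewrite real_normK ?num_real// ler_piMr ?sqr_ge0// indicE.
Qed.

Lemma gated_dir_Va j w : gated_dir j w != 0 -> (Va j w <= K%:E)%E.
Proof.
rewrite /gated_dir; have [->|[_ _ _ []]//] := gateP j w.
by rewrite mul0r scale0r eqxx.
Qed.

(** The gate makes the variance proportional to [pr A], so that the estimates are relative to the
    starting event. *)
Lemma gated_mart_sq : (n <= k)%N ->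
  sq_integ P (mart dot eps gated_dir k m) /\
  \int[P]_w (mart dot eps gated_dir k m w ^+ 2) <= (K1 + K) * (sigma ^+ 2 * pr A).
Proof.
move=> nk; have [sq _ le] := mart_sq hF heps eps_centered hVa hK1
  adapted_gated_dir (fun j => gated_dir_le j) (fun j => @gated_dir_Va j) k m.
split=> //; apply: le_trans le _; rewrite ler_wpM2l//.
  by rewrite addr_ge0.
have mA := mT FA.
rewrite -c2 mulr_suml (@le_trans _ _ (\sum_(k <= j < m) c j.+1 ^+ 2 * pr A))//.
  apply: ler_sum => j _; rewrite -Rint_indic// -RintegralZl//; last first.
    exact: integ_indic.
  have mn : measurable_fun setT (fun w => nrm (gated_dir j w) ^+ 2).
    apply: measurable_funX; apply: measurable_dot_norm => i.
    exact: measurable_wrtT (@adapted_gated_dir j i).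
  have ic : integ (fun w => c j.+1 ^+ 2 * \1_A w).
    by apply: integ_scale; exact: integ_indic.
  apply: le_Rint => //; last exact: gated_dir_sq.
  apply: integ_le ic => // w; rewrite ger0_norm ?sqr_ge0//.
  exact: gated_dir_sq.
have [km|mk] := leqP k m; last first.
  rewrite big_geq ?(ltnW mk)// sumr_ge0// => j _.
  by rewrite mulr_ge0 ?sqr_ge0 ?fine_ge0.
rewrite [leRHS](big_cat_nat nk km)/= lerDr sumr_ge0// => j _.
by rewrite mulr_ge0 ?sqr_ge0 ?fine_ge0.
Qed.

(** On [A] and [D] every gate is open, so the gated martingale is the sum in [norm_le_mart]. *)
Lemma norm_le_gated_mart w : (n <= k < m)%N -> A w -> D w ->
  nrm (W k w) <= - mart dot eps gated_dir k m w + 2 * eta * sigma.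
Proof.
move=> knm Aw Dw; have /andP[nk km] := knm.
have xS j : (n <= j < m)%N ->
    X j.+1 w = W j w + c j.+1 *: (eps j.+1 w + r j.+1 w).
  by move=> /(D_ok Dw)[].
have xW j : (n <= j < m)%N -> nrm (X j w) <= nrm (W j w) by move=> /(D_ok Dw)[].
rewrite /mart; under eq_big_nat => j /andP[kj jm].
  have [ok _ _] : [/\ moments_ok j w, nrm (X j w) <= nrm (W j w) &
      X j.+1 w = W j w + c j.+1 *: (eps j.+1 w + r j.+1 w)].
    by apply: D_ok => //; rewrite (leq_trans nk kj).
  rewrite /gated_dir gate1// mul1r; over.
exact: (norm_le_mart (r := r^~ w) (e := eps^~ w) sigma_gt0 eta_gt0 c2 (D_r Dw)
  (D_X Dw) xS xW).
Qed.

(* Chebyshev: on [E] the gated martingale is at least [(L - 2 * eta) * sigma]. *)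
Lemma far_le (E : set T) : (n <= k < m)%N -> measurable E -> E `<=` A `&` D ->
  (forall w, E w -> L * sigma <= nrm (W k w)) ->
  (L - 2 * eta) ^+ 2 * pr E <= (K1 + K) * pr A.
Proof.
move=> knm mE EAD EW; have /andP[nk km] := knm.
have [[msq isq] le] := gated_mart_sq nk.
have s2 : 0 < sigma ^+ 2 by rewrite exprn_gt0.
rewrite -(ler_pM2l s2); apply: le_trans (_ : _ <= (K1 + K) * (sigma ^+ 2 * pr A)) _;
  last by rewrite mulrCA.
apply: le_trans le; rewrite -Rint_indic// mulrA -RintegralZl//; last first.
  exact: integ_indic.
apply: le_Rint => //; first by apply: integ_scale; exact: integ_indic.
move=> w; rewrite indicE; case: (boolP (w \in E)); last first.
  by rewrite mulr0 sqr_ge0.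
rewrite inE mulr1 => Ew; have [Aw Dw] := EAD _ Ew; rewrite -exprMn.
have h2 := norm_le_gated_mart knm Aw Dw; have h1 := EW _ Ew.
rewrite -[leRHS]sqrrN lerXn2r ?nnegrE//.
- by rewrite mulr_ge0 ?ltW// subr_gt0.
- have : 0 < (L - 2 * eta) * sigma by rewrite mulr_gt0// subr_gt0.
  lra.
- lra.
Qed.

End Gate.

Let mB : measurable B. Proof. exact: mT FB. Qed.

(** * Exit from the ball of radius [L * sigma] *)

Definition exceed k : set T := B `&` [set w | L * sigma <= nrm (W k w)].

Lemma F_exceed k : (n <= k)%N -> F k (exceed k).
Proof.
move=> nk; apply: eventI => //; first exact: (FF nk).
by apply: event_le => //; exact: measurable_cst.
Qed.

Definition exceeded l : set T := \big[setU/set0]_(n <= k < l) exceed k.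

Lemma exceededS l : (n <= l)%N -> exceeded l.+1 = exceeded l `|` exceed l.
Proof. by move=> nl; rewrite /exceeded big_nat_recr. Qed.

Lemma F_exceeded l : F l (exceeded l).
Proof.
elim: l => [|l ih].
  by rewrite /exceeded big_geq//; apply/(eventP (sF 0)); exact: measurable0.
have [nl|ln] := leqP n l; last first.
  by rewrite /exceeded big_geq//; apply/(eventP (sF l.+1)); exact: measurable0.
rewrite exceededS//; apply: eventU => //; first exact: (FF (leqnSn l)).
by apply: (FF (leqnSn l)); exact: F_exceed.
Qed.

Lemma exceeded_sub l : exceeded l `<=` B.
Proof.
elim: l => [|l ih]; first by rewrite /exceeded big_geq.
have [nl|ln] := leqP n l; last by rewrite /exceeded big_geq.
by rewrite exceededS// => w [/ih|[]].
Qed.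

Lemma not_exceeded k w : (n <= k < m)%N -> B w -> ~ exceeded m w ->
  nrm (W k w) < L * sigma.
Proof.
move=> /andP[nk km] Bw; rewrite ltNge; apply: contra_notN => LW.
rewrite /exceeded -bigcup_seq_cond; exists k => //=.
by rewrite mem_index_iota nk km.
Qed.

(* [far_le] is summed over the first time at which [W] leaves the ball. *)
Lemma exceeded_le l : (l <= m)%N ->
  (L - 2 * eta) ^+ 2 * pr (D `&` exceeded l) <= (K1 + K) * pr (exceeded l).
Proof.
elim: l => [|l ih] lm.
  by rewrite /exceeded big_geq// setI0 measure0/= !mulr0.
have [nl|ln] := leqP n l; last first.
  by rewrite /exceeded big_geq// setI0 measure0/= !mulr0.
have mU k : measurable (exceeded k) by exact: mT (@F_exceeded k).
have FE := F_exceed nl; have mE := mT FE.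
have mED := mT (eventD (sF l) FE (@F_exceeded l)).
have mDU : measurable (D `&` exceeded l) by exact: measurableI.
have DsplitU : pr (D `&` exceeded l.+1) =
    pr (D `&` exceeded l) + pr (D `&` (exceed l `\` exceeded l)).
  rewrite (@pr_setID _ _ _ P _ (exceeded l)) ?exceededS//; last first.
    by apply: measurableI => //; exact: measurableU.
  rewrite -setIA setIUl setIid setUidl; last by move=> w [].
  by rewrite setIDA setIUr setDUl -!setIDA setDv setI0 set0U.
have splitU : pr (exceeded l.+1) =
    pr (exceeded l) + pr (exceed l `\` exceeded l).
  rewrite (@pr_setID _ _ _ P _ (exceeded l)) ?exceededS//; last exact: measurableU.
  rewrite setIUl setIid setUidl; last by move=> w [].
  by rewrite setDUl setDv set0U.
rewrite DsplitU splitU !mulrDr lerD//; first exact: ih (ltnW lm).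
(* The starting event is that of a first exit at time [l], which belongs to [F l]. *)
apply: (@far_le _ l) => //.
- exact: eventD (@F_exceeded l).
- by rewrite nl.
- exact: measurableI.
- by move=> w [].
- by move=> w [_ [[_ /= ]]].
Qed.

Definition kept : set T := D `\` exceeded m.

Let mU : measurable (exceeded m). Proof. exact: mT (@F_exceeded m). Qed.
Let mkept : measurable kept. Proof. exact: measurableD. Qed.
Let mlost : measurable (B `\` kept). Proof. exact: measurableD. Qed.

(** A lost path lies outside [D], or it lies in [D] and has left the ball; [exceeded_le] makes the
    second kind a part of [B] of relative size [O(L ^- 2)]. *)
Lemma lost_le : (L - 2 * eta) ^+ 2 * pr (B `\` kept) <=
  (L - 2 * eta) ^+ 2 * pr (B `\` D) + (K1 + K) * pr B.
Proof.
rewrite (@pr_setID _ _ _ P (B `\` kept) D)// mulrDr [leRHS]addrC lerD//;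
    last first.
  rewrite ler_wpM2l ?sqr_ge0//; apply: pr_le; try exact: measurableD.
  by move=> w [[]].
apply: (@le_trans _ _ ((L - 2 * eta) ^+ 2 * pr (D `&` exceeded m))).
  rewrite ler_wpM2l ?sqr_ge0//; apply: pr_le; try exact: measurableI.
  move=> w [[Bw nk] Dw]; split=> //; apply: contrapT => nU; exact: nk.
apply: le_trans (exceeded_le (leqnn m)) _.
by rewrite ler_wpM2l ?addr_ge0// pr_le//; exact: exceeded_sub.
Qed.

(** * Second moments inside the ball *)

Definition near_set j : set T := [set w | nrm (W j w) <= L * sigma].

(** Each time is tested on its own instead of stopping at the first exit. This suffices because on
    [kept] all these gates are open between [n] and [m]. *)
Definition near_gate j w : R := gate B n j w * \1_(near_set j) w.

Let L_gt0 : 0 < L. Proof. by apply: lt_trans L_eta; rewrite mulr_gt0. Qed.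

Lemma F_near j : F j (near_set j).
Proof. by apply: event_le => //; exact: measurable_cst. Qed.

Lemma near_gateP j w :
  near_gate j w = 0 \/ [/\ near_gate j w = 1, (n <= j)%N, B w, moments_ok j w &
    nrm (W j w) <= L * sigma].
Proof.
rewrite /near_gate; have [->|[-> nj Bw ok]] := gateP B n j w.
  by left; rewrite mul0r.
rewrite mul1r indicE; case: (boolP (w \in _)) => [|_]; last by left.
by rewrite inE; right.
Qed.

Lemma near_gate_kept j w : (n <= j < m)%N -> kept w -> near_gate j w = 1.
Proof.
move=> jnm [Dw nU]; have [ok _ _] := D_ok Dw jnm.
have Bw := DB Dw; rewrite /near_gate gate1//; last by case/andP: jnm.
by rewrite indicE mem_set ?mulr1//; apply: ltW; exact: not_exceeded.
Qed.

Lemma near_gate01 j w : 0 <= near_gate j w <= 1.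
Proof. by have [->|[->]] := near_gateP j w; rewrite lexx ler01. Qed.

Lemma measurable_near_gate j : measurable_wrt (F j) (near_gate j).
Proof.
apply: (@measurable_funM _ (g_sigma_algebraType (F j))).
  exact: measurable_gate FB _.
by apply: measurable_wrt_indic => //; exact: F_near.
Qed.

Let mgT j : measurable_fun setT (near_gate j).
Proof. exact: measurable_wrtT (@measurable_near_gate j). Qed.

Let mWT j : measurable_fun setT (fun w => nrm (W j w)).
Proof. exact: measurable_wrtT (@mnW j). Qed.

Let gate_int j : integ (near_gate j).
Proof.
apply: (@integ_bounded _ _ _ _ _ 1) => // w.
by have /andP[g0 g1] := near_gate01 j w; rewrite ger0_norm.
Qed.

Lemma near_norm_le j w : near_gate j w * nrm (W j w) ^+ 2 <= (L * sigma) ^+ 2.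
Proof.
have [->|[-> _ _ _ h]] := near_gateP j w; first by rewrite mul0r sqr_ge0.
by rewrite mul1r lerXn2r ?nnegrE ?dot_norm_ge0// mulr_ge0// ltW.
Qed.

Let near_norm_int j : integ (fun w => near_gate j w * nrm (W j w) ^+ 2).
Proof.
apply: (@integ_bounded _ _ _ _ _ ((L * sigma) ^+ 2)).
  by apply: measurable_funM => //; exact: measurable_funX.
move=> w; rewrite ger0_norm ?near_norm_le//.
by rewrite mulr_ge0 ?sqr_ge0//; case/andP: (near_gate01 j w).
Qed.

Local Notation Q := (2 * (K1 + K) * pr B + 8 * eta ^+ 2 * pr B +
  L ^+ 2 * pr (B `\` kept)).

(** On [kept], [norm_le_gated_mart] controls [W] with constants free of [L]. Elsewhere only the
    radius of the ball is available, which costs [L ^+ 2] times the lost probability. When [D] fills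
    most of [B] that probability is [O(L ^- 2)], so [Q] stays comparable to [pr B] as [L] grows. *)
Lemma near_second_moment j : (n <= j < m)%N ->
  \int[P]_w (near_gate j w * nrm (W j w) ^+ 2) <= sigma ^+ 2 * Q.
Proof.
move=> jnm; have /andP[nj jm] := jnm.
have FjB : F j B by exact: (FF nj).
have [[msq isq] le] := gated_mart_sq FjB nj.
set M := mart _ _ _ _ _ in msq isq le.
pose f w := 2 * M w ^+ 2 + (8 * eta ^+ 2 * sigma ^+ 2) * \1_B w +
  (L * sigma) ^+ 2 * \1_(B `\` kept) w.
have if1 : integ (fun w => 2 * M w ^+ 2) by exact: integ_scale.
have if2 : integ (fun w => (8 * eta ^+ 2 * sigma ^+ 2) * \1_B w).
  by apply: integ_scale; exact: integ_indic.
have if3 : integ (fun w => (L * sigma) ^+ 2 * \1_(B `\` kept) w).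
  by apply: integ_scale; exact: integ_indic.
have if12 := integ_add if1 if2.
have fi : integ f by exact: integ_add.
apply: (@le_trans _ _ (\int[P]_w f w)); last first.
  rewrite /f RintegralD// RintegralD// !RintegralZl//; try exact: integ_indic.
  rewrite !Rint_indic//; move: le; nra.
apply: le_Rint => // w; rewrite /f.
have [->|[-> _ Bw ok nW]] := near_gateP j w.
  have c0 : 0 <= 8 * eta ^+ 2 * sigma ^+ 2.
    by apply: mulr_ge0; [apply: mulr_ge0|]; rewrite ?sqr_ge0.
  rewrite mul0r; apply: addr_ge0; [apply: addr_ge0|]; apply: mulr_ge0 => //;
    exact: sqr_ge0.
rewrite mul1r [\1_B w]indicE mem_set// mulr1.
have [kw|nkw] := pselect (kept w); last first.
  rewrite indicE mem_set// mulr1.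
  have : nrm (W j w) ^+ 2 <= (L * sigma) ^+ 2.
    by rewrite lerXn2r ?nnegrE ?dot_norm_ge0// mulr_ge0// ltW.
  have := sqr_ge0 (M w); have := sqr_ge0 (eta * sigma); rewrite !exprMn; lra.
have [Dw _] := kw.
have h : nrm (W j w) <= - M w + 2 * eta * sigma by exact: norm_le_gated_mart.
have -> : \1_(B `\` kept) w = 0 :> R.
  by rewrite indicE memNset// => -[_]; exact.
rewrite mulr0 addr0.
have h2 : nrm (W j w) ^+ 2 <= (- M w + 2 * eta * sigma) ^+ 2.
  rewrite lerXn2r ?nnegrE ?dot_norm_ge0//.
  by apply: le_trans h; exact: dot_norm_ge0.
have := sqr_ge0 (M w + 2 * eta * sigma).
move: h2; nra.
Qed.


Definition near_dir j w : 'rV[R]_d := (near_gate j w * (2 * c j.+1)) *: W j w.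

Lemma adapted_near_dir : adapted F near_dir.
Proof.
move=> j i; rewrite /near_dir; under eq_fun do rewrite mxE.
apply: (@measurable_funM _ (g_sigma_algebraType (F j))); last exact: hW.
apply: (@measurable_funM _ (g_sigma_algebraType (F j))).
  exact: measurable_near_gate.
exact: measurable_cst.
Qed.

Lemma near_dir_sq j w :
  nrm (near_dir j w) ^+ 2 = 4 * c j.+1 ^+ 2 * (near_gate j w * nrm (W j w) ^+ 2).
Proof.
rewrite /near_dir dot_normZ exprMn real_normK ?num_real//.
by have [->|[-> _ _ _ _]] := near_gateP j w; ring.
Qed.

Lemma near_dir_le j w : nrm (near_dir j w) <= 2 * `|c j.+1| * (L * sigma).
Proof.
have b0 : 0 <= L * sigma by rewrite mulr_ge0// ltW.
have b1 : 0 <= 2 * `|c j.+1| * (L * sigma) by apply: mulr_ge0; first exact: mulr_ge0.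
rewrite -(@ler_pXn2r _ 2)// ?nnegrE ?dot_norm_ge0// near_dir_sq [leRHS]exprMn.
apply: ler_pM; last exact: near_norm_le.
- by rewrite mulr_ge0 ?sqr_ge0.
- by rewrite mulr_ge0 ?sqr_ge0//; case/andP: (near_gate01 j w).
- by rewrite exprMn real_normK ?num_real// -natrX.
Qed.

Lemma near_dir_Va j w : near_dir j w != 0 -> (Va j w <= K%:E)%E.
Proof.
rewrite /near_dir; have [->|[_ _ _ [] //]] := near_gateP j w.
by rewrite mul0r scale0r eqxx.
Qed.

Let N := mart dot eps near_dir n m.

Lemma near_mart_sq : [/\ sq_integ P N, \int[P]_w N w = 0 &
  \int[P]_w (N w ^+ 2) <= (K1 + K) * (4 * sigma ^+ 4 * Q)].
Proof.
have [sq z le] := mart_sq hF heps eps_centered hVa hK1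
  adapted_near_dir near_dir_le near_dir_Va n m.
split=> //; apply: le_trans le _; rewrite ler_wpM2l ?addr_ge0//.
apply: (@le_trans _ _ (\sum_(n <= j < m) c j.+1 ^+ 2 * (4 * (sigma ^+ 2 * Q)))).
  apply: ler_sum_nat => j jnm; under eq_Rintegral do rewrite near_dir_sq.
  rewrite RintegralZl// -mulrA mulrCA ler_wpM2l ?sqr_ge0// ler_wpM2l//.
  exact: near_second_moment.
by rewrite -mulr_suml c2 le_eqVlt; apply/orP; left; apply/eqP; ring.
Qed.

Let e2 j w := nrm (eps j.+1 w) ^+ 2.
Let S w := \sum_(n <= j < m) c j.+1 ^+ 2 * (near_gate j w * e2 j w).

Let e2_int (C : set T) j : measurable C ->
  integ (fun w => near_gate j w * e2 j w * \1_C w) /\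
  \int[P]_w (near_gate j w * e2 j w * \1_C w) <=
    Lam * \int[P]_w (near_gate j w * \1_C w) + theta * (K * \int[P]_w near_gate j w).
Proof.
move=> mC; apply: (moment_2_le (sF j) (@subF j) (@mepsT j.+1) (hVa j) (b := 1)) => //.
- exact: measurable_near_gate.
- exact: near_gate01.
- move=> w; have [->|[_ _ _ [] //]] := near_gateP j w.
  by rewrite eqxx.
Qed.

Let e2_intT j : integ (fun w => near_gate j w * e2 j w).
Proof.
have [+ _] := e2_int j measurableT; apply: eq_integrable => // w _ /=.
by rewrite indicT mulr1.
Qed.

Let S_int : integ S.
Proof. by apply: integ_sum => j; exact: integ_scale. Qed.

(** The gates equal 1 on [kept], so each dominates the indicator of [B] minus that of the lost
    event; [moment_2_ge] supplies the factor [v]. *)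
Lemma S_ge : v * sigma ^+ 2 * (pr B - pr (B `\` kept)) <= \int[P]_w S w.
Proof.
rewrite /S Rint_sum; last by move=> j; exact: integ_scale.
rewrite -mulrA mulrCA -c2 mulr_suml; apply: ler_sum_nat => j jnm.
rewrite RintegralZl// ler_wpM2l ?sqr_ge0//.
have : v * \int[P]_w near_gate j w <= \int[P]_w (near_gate j w * e2 j w).
  apply: (moment_2_ge (sF j) (@subF j) (@mepsT j.+1) (hV2 j)) => //.
  - exact: measurable_near_gate.
  - by move=> w; case/andP: (near_gate01 j w).
  - move=> w; have [->|[_ _ _ [] //]] := near_gateP j w.
    by rewrite eqxx.
apply: le_trans.
rewrite ler_wpM2l// -!Rint_indic// -RintegralB//; try exact: integ_indic.
apply: le_Rint => //.
  exact: (integrableB measurableT (integ_indic P mB) (integ_indic P mlost)).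
move=> w; have /andP[g0 g1] := near_gate01 j w.
rewrite !indicE; case: (boolP (w \in B `\` kept)) => [|/negP]; rewrite inE.
  by move=> [Bw _]; rewrite mem_set// subrr.
move=> nl; rewrite subr0; case: (boolP (w \in B)) => //; rewrite inE => Bw.
have kw : kept w by apply: contrapT => nk; apply: nl.
by rewrite near_gate_kept.
Qed.

(** Uniform integrability of [S]. The lost event need not be known at time [j], which is why
    [moment_2_le] allows an arbitrary measurable set. *)
Lemma S_lost_le : Lam >= 0 ->
  integ (fun w => S w * \1_(B `\` kept) w) /\
  \int[P]_w (S w * \1_(B `\` kept) w) <=
  sigma ^+ 2 * (Lam * pr (B `\` kept) + theta * K * pr B).
Proof.
move=> Lam0; have E w : S w * \1_(B `\` kept) w = \sum_(n <= j < m)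
    c j.+1 ^+ 2 * (near_gate j w * e2 j w * \1_(B `\` kept) w).
  by rewrite /S mulr_suml; apply: eq_bigr => j _; rewrite !mulrA.
have int j : integ (fun w => c j.+1 ^+ 2 *
    (near_gate j w * e2 j w * \1_(B `\` kept) w)).
  by apply: integ_scale; have [] := e2_int j mlost.
split.
  by under [X in integ X]eq_fun do rewrite E; exact: integ_sum.
under eq_Rintegral do rewrite E.
rewrite Rint_sum// -c2 mulr_suml; apply: ler_sum_nat => j jnm.
have [i1 le] := e2_int j mlost.
rewrite RintegralZl// ler_wpM2l ?sqr_ge0//; apply: le_trans le _.
have gi : integ (fun w => near_gate j w * \1_(B `\` kept) w).
  apply: (@integ_bounded _ _ _ _ _ 1); first exact: measurable_funM.
  move=> w; have /andP[g0 g1] := near_gate01 j w; rewrite normrM ger0_norm//.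
  by rewrite indicE; case: (w \in _); rewrite ?normr1 ?normr0 ?mulr1 ?mulr0.
rewrite -mulrA lerD// !ler_wpM2l//.
- rewrite -Rint_indic//; apply: le_Rint => //; first exact: integ_indic.
  move=> w; have /andP[g0 g1] := near_gate01 j w.
  by rewrite ler_piMl// indicE; case: (w \in _).
- rewrite -Rint_indic//; apply: le_Rint => //; first exact: integ_indic.
  move=> w; have [->|[-> _ Bw _ _]] := near_gateP j w; last by rewrite indicE mem_set.
  by rewrite indicE; case: (w \in _).
Qed.

(** The pointwise bound [key] is integrated. On [kept] it is [sqr_norm_ge]; on the lost event [N] is
    bounded by Young's inequality with free parameter [t], and [S] is left as it is. Since [N] has
    mean 0, the left side reduces to the lower bound on [S]. Dividing by [sigma ^+ 2] removes the
    scale. *)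
Lemma horizon_balance (t : R) : 0 < t -> 0 <= Lam ->
  v / 2 * (pr B - pr (B `\` kept)) <=
  (2 * L * eta + 2 * eta ^+ 2) * pr B + 2 * t * (K1 + K) * Q +
  pr (B `\` kept) / (2 * t) +
  (Lam * pr (B `\` kept) + theta * K * pr B) / 2.
Proof.
move=> t0 Lam0; have s2 : 0 < sigma ^+ 2 by rewrite exprn_gt0.
have [[mN iN2] N0 N2le] := near_mart_sq.
have iN : integ N by exact: sq_integ_integ.
have [iSl Sl_le] := S_lost_le Lam0.
pose lhs w := N w + 2^-1 * S w.
pose r1 w := (2 * L * eta + 2 * eta ^+ 2) * sigma ^+ 2 * \1_B w : R.
pose r2 w := t / (2 * sigma ^+ 2) * N w ^+ 2.
pose r3 w := sigma ^+ 2 / (2 * t) * \1_(B `\` kept) w : R.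
pose r4 w := 2^-1 * (S w * \1_(B `\` kept) w).
have ir1 : integ r1 by apply: integ_scale; exact: integ_indic.
have ir2 : integ r2 by exact: integ_scale.
have ir3 : integ r3 by apply: integ_scale; exact: integ_indic.
have ir4 : integ r4 by exact: integ_scale.
have ir12 := integ_add ir1 ir2; have ir34 := integ_add ir3 ir4.
have iS2 : integ (fun w => 2^-1 * S w) by exact: integ_scale.
have coef1 : 0 <= (2 * L * eta + 2 * eta ^+ 2) * sigma ^+ 2.
  rewrite mulr_ge0 ?sqr_ge0// addr_ge0 ?mulr_ge0 ?sqr_ge0 ?ltW//.
have S0 w : 0 <= S w.
  apply: sumr_ge0 => j _; rewrite mulr_ge0 ?sqr_ge0// mulr_ge0 ?sqr_ge0//.
  by case/andP: (near_gate01 j w).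
have r20 w : 0 <= r2 w by rewrite mulr_ge0 ?sqr_ge0// divr_ge0 ?mulr_ge0// ltW.
have key w : lhs w <= (r1 w + r2 w) + (r3 w + r4 w).
  rewrite /lhs /r1 /r3 /r4.
  have [Bw|nBw] := pselect (B w); last first.
    have g0 j : near_gate j w = 0 by have [//|[_ _ /nBw]] := near_gateP j w.
    have -> : N w = 0.
      rewrite /N /mart big1// => j _; rewrite /near_dir g0 mul0r scale0r.
      by rewrite linear0l.
    have -> : S w = 0 by rewrite /S big1// => j _; rewrite g0 mul0r mulr0.
    rewrite !indicE memNset// memNset//; last by move=> [].
    by rewrite !mulr0 !add0r !addr0.
  rewrite [\1_B w]indicE mem_set// mulr1.
  have [kw|nkw] := pselect (kept w).
    have -> : \1_(B `\` kept) w = 0 :> R by rewrite indicE memNset// => -[_].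
    rewrite !mulr0 !addr0; have [Dw nU] := kw.
    have xS i : (n <= i < m)%N ->
        X i.+1 w = W i w + c i.+1 *: (eps i.+1 w + r i.+1 w).
      by move=> /(D_ok Dw)[].
    have xW i : (n <= i < m)%N -> nrm (X i w) <= nrm (W i w) by move=> /(D_ok Dw)[].
    have WL i : (n <= i < m)%N -> nrm (W i w) <= L * sigma.
      by move=> inm; apply: ltW; apply: not_exceeded.
    have := sqr_norm_ge (r := r^~ w) (e := eps^~ w) sigma_gt0 eta_gt0 c2 (D_r Dw)
      (D_X Dw) xS xW WL.
    have -> : N w = \sum_(n <= k < m)
        dot ((2 * c k.+1) *: W k w) (eps k.+1 w).
      by apply: eq_big_nat => j jnm; rewrite /near_dir near_gate_kept// mul1r.
    have -> : S w = \sum_(n <= k < m) c k.+1 ^+ 2 * nrm (eps k.+1 w) ^+ 2.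
      by apply: eq_big_nat => j jnm; rewrite near_gate_kept// mul1r.
    by move=> h; apply: le_trans h _; rewrite lerDl.
  have -> : \1_(B `\` kept) w = 1 :> R by rewrite indicE mem_set.
  rewrite !mulr1 addrA lerD2r -addrA -[leLHS]add0r lerD//.
  (* [N w <= t / (2 * sigma ^+ 2) * N w ^+ 2 + sigma ^+ 2 / (2 * t)] *)
  rewrite -subr_ge0 /r2.
  have -> : t / (2 * sigma ^+ 2) * N w ^+ 2 + sigma ^+ 2 / (2 * t) - N w =
      (t * N w - sigma ^+ 2) ^+ 2 / (2 * t * sigma ^+ 2).
    by field; rewrite !gt_eqF.
  by rewrite divr_ge0 ?sqr_ge0// !mulr_ge0// ltW.
have ilhs : integ lhs by exact: integ_add.
have := le_Rint ilhs (integ_add ir12 ir34) key.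
rewrite (RintegralD measurableT iN iS2) N0 add0r RintegralZl//.
rewrite (RintegralD measurableT ir12 ir34) (RintegralD measurableT ir1 ir2).
rewrite (RintegralD measurableT ir3 ir4).
have -> : \int[P]_w r1 w = (2 * L * eta + 2 * eta ^+ 2) * sigma ^+ 2 * pr B.
  by rewrite RintegralZl ?Rint_indic//; exact: integ_indic.
have -> : \int[P]_w r2 w = t / (2 * sigma ^+ 2) * \int[P]_w N w ^+ 2.
  by rewrite RintegralZl.
have -> : \int[P]_w r3 w = sigma ^+ 2 / (2 * t) * pr (B `\` kept).
  by rewrite RintegralZl ?Rint_indic//; exact: integ_indic.
have -> : \int[P]_w r4 w = 2^-1 * \int[P]_w (S w * \1_(B `\` kept) w).
  by rewrite RintegralZl.
move=> main.
rewrite -(ler_pM2l s2); have := S_ge.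
have : t / (2 * sigma ^+ 2) * \int[P]_w N w ^+ 2 <=
    t / (2 * sigma ^+ 2) * ((K1 + K) * (4 * sigma ^+ 4 * Q)).
  by rewrite ler_wpM2l// divr_ge0 ?mulr_ge0// ltW.
have -> : t / (2 * sigma ^+ 2) * ((K1 + K) * (4 * sigma ^+ 4 * Q)) =
    sigma ^+ 2 * (2 * t * (K1 + K) * Q) by field; rewrite gt_eqF.
have -> : sigma ^+ 2 * ((2 * L * eta + 2 * eta ^+ 2) * pr B + 2 * t * (K1 + K) * Q +
  pr (B `\` kept) / (2 * t) +
  (Lam * pr (B `\` kept) + theta * K * pr B) / 2) =
  (2 * L * eta + 2 * eta ^+ 2) * sigma ^+ 2 * pr B +
  sigma ^+ 2 * (2 * t * (K1 + K) * Q) + sigma ^+ 2 / (2 * t) * pr (B `\` kept) +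
  sigma ^+ 2 * (Lam * pr (B `\` kept) + theta * K * pr B) / 2.
  by field; rewrite gt_eqF.
move: main Sl_le; lra.
Qed.

End Horizon.

(** * Escape of a fixed proportion of paths *)

Section Escape.
Variables (R : realType) (d : nat) (dot : {dot 'rV[R]_d for idfun}).
Variables (disp : measure_display) (T : measurableType disp).
Variables (P : probability T R) (F : nat -> set (set T)).
Hypothesis hF : filtration F.
Variables (W eps : nat -> T -> 'rV[R]_d).
Local Notation nrm := (dot_norm dot).
Local Notation pr A := (fine (P A)).
Hypotheses (hW : adapted F W) (heps : adapted F eps).
Hypothesis eps_centered : forall n, condexp_vec P (F n) (eps n.+1) (fun=> 0).
Variables (a v K : R) (V2 Va : nat -> T -> \bar R).
Hypothesis hV2 : forall n,
  condexp_ge0 P (F n) (fun w => (nrm (eps n.+1 w) ^+ 2)%:E) (V2 n).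
Hypothesis hVa : forall n,
  condexp_ge0 P (F n) (fun w => (nrm (eps n.+1 w) `^ a)%:E) (Va n).
Hypotheses (a_gt2 : 2 < a) (v_gt0 : 0 < v) (K_gt0 : 0 < K).

(** What matters is the order of quantifiers: [delta] and [eta] come before the horizon, its scale
    and the events. If fewer paths escaped, [horizon_balance] would bound [v / 2 * pr B] by four
    terms, each at most [v / 16 * pr B]. *)
Lemma horizon_escape : exists delta eta : R, [/\ 0 < delta, 0 < eta &
  forall (X r : nat -> T -> 'rV[R]_d) (c : nat -> R) (n m : nat) (B D : set T),
  F n B -> measurable D -> D `<=` B ->
  0 < \sum_(n <= k < m) c k.+1 ^+ 2 ->
  (forall w, D w -> forall k, (n <= k < m)%N ->
    [/\ moments_ok v K V2 Va k w, nrm (X k w) <= nrm (W k w) &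
      X k.+1 w = W k w + c k.+1 *: (eps k.+1 w + r k.+1 w)]) ->
  (forall w, D w -> \sum_(n <= k < m) nrm (r k.+1 w) ^+ 2 <= eta ^+ 2) ->
  (forall w, D w ->
    nrm (X m w) <= eta * Num.sqrt (\sum_(n <= k < m) c k.+1 ^+ 2)) ->
  delta * pr B <= pr (B `\` D)].
Proof.
have [K1 K1_ge0 hK1] := sqr_le_powR a_gt2 (@ltr01 R).
(* This makes [theta * K / 2], the price of uniform integrability, equal to [v / 16]. *)
pose theta := v / (8 * K).
have theta0 : 0 < theta by rewrite divr_gt0// mulr_gt0.
have [Lam Lam0 hLam] := sqr_le_powR a_gt2 theta0.
pose K2 := K1 + K; have K2_gt0 : 0 < K2 by rewrite ltr_wpDl.
(* [beta] will bound [L ^+ 2] times the relative size of the lost event, and [s] the ratio of [Q] to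
   [pr B]; [t] is tuned so that the variance of [N] costs at most [v / 16]. *)
pose beta := 1 + 4 * K2; have beta_gt0 : 0 < beta by rewrite addr_gt0// mulr_gt0.
pose s := 2 * K2 + 8 + beta; have s_gt0 : 0 < s by rewrite /s /beta; lra.
pose t := v / (32 * K2 * s); have t_gt0 : 0 < t by rewrite divr_gt0// !mulr_gt0.
have tE : 2 * t * K2 * s = v / 16 by rewrite /t; field; rewrite !gt_eqF.
clearbody t.
(* [kappa] collects the coefficients of the lost probability in the balance; [L] is then so large
   that [kappa * beta <= v / 16 * L ^+ 2]. *)
pose kappa := v / 2 + (2 * t)^-1 + Lam / 2.
have kappa_gt0 : 0 < kappa.
  have i0 : 0 < (2 * t)^-1 by rewrite invr_gt0 mulr_gt0.
  by rewrite /kappa ltr_wpDr ?divr_ge0// addr_gt0// divr_gt0.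
pose L := 1 + 16 * kappa * beta / v.
have L1 : 1 <= L by rewrite /L lerDl divr_ge0 ?mulr_ge0// ltW.
have L_gt0 : 0 < L by exact: lt_le_trans L1.
(* The first bound keeps [L - 2 * eta] at least [L / 2], the second makes
   [2 * L * eta + 2 * eta ^+ 2] at most [v / 16]. *)
pose eta := Num.min 4^-1 (v / (64 * L)).
have eta_gt0 : 0 < eta.
  by rewrite /eta lt_min invr_gt0 ltr0n/= divr_gt0// mulr_gt0.
have eta4 : eta <= 4^-1 by rewrite /eta ge_min lexx.
have etaL : L * eta <= v / 64.
  have : eta <= v / (64 * L) by rewrite /eta ge_min lexx orbT.
  move=> /(ler_wpM2l (ltW L_gt0)) h; apply: le_trans h _.
  by rewrite le_eqVlt; apply/orP; left; apply/eqP; field; rewrite gt_eqF.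
have LE : v / 16 * L = v / 16 + kappa * beta by rewrite /L; field; rewrite gt_eqF.
have thetaE : theta * K / 2 = v / 16 by rewrite /theta; field; rewrite gt_eqF.
clearbody eta L theta.
exists (L ^+ 2)^-1, eta; split=> //; first by rewrite invr_gt0 exprn_gt0.
move=> X r c n m B D FB mD DB c_gt0 D_ok D_r D_X.
pose sigma := Num.sqrt (\sum_(n <= k < m) c k.+1 ^+ 2).
have sigma_gt0 : 0 < sigma by rewrite sqrtr_gt0.
have c2 : \sum_(n <= k < m) c k.+1 ^+ 2 = sigma ^+ 2 by rewrite sqr_sqrtr// ltW.
have L_eta : 2 * eta < L by lra.
have bal := horizon_balance hF hW heps eps_centered hV2 hVa hK1 hLam (ltW v_gt0)
  (ltW K_gt0) K1_ge0 (ltW theta0) sigma_gt0 eta_gt0 L_eta c2 FB mD DB D_ok D_r D_X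
  t_gt0 Lam0.
have lost := lost_le hF hW heps eps_centered hV2 hVa hK1 (ltW K_gt0) K1_ge0
  sigma_gt0 eta_gt0 L_eta c2 FB mD D_ok D_r D_X.
move: bal lost; rewrite -/K2.
set p := pr (B `\` kept _ _ _ _ _ _ _ _); set q := pr (B `\` D); set b := pr B.
move=> bal lost; rewrite leNgt; apply/negP => qb.
have p0 : 0 <= p by exact: pr_ge0.
have q0 : 0 <= q by exact: pr_ge0.
have L2_gt0 : 0 < L ^+ 2 by rewrite exprn_gt0.
have b_gt0 : 0 < b by rewrite -(@pmulr_rgt0 _ (L ^+ 2)^-1) ?invr_gt0// (le_lt_trans q0).
have Lq : L ^+ 2 * q <= b by rewrite -ler_pdivlMl// ltW.
have Lp : L ^+ 2 * p <= beta * b.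
  (* If [p] exceeds [q], [lost_le] bounds the excess, and [L ^+ 2 / 4 <= (L - 2 * eta) ^+ 2]
     accounts for the 4 in [beta]. *)
  have [pq|qp] := leP p q.
    apply: (@le_trans _ _ (L ^+ 2 * q)); first by rewrite ler_wpM2l// ltW.
    by apply: le_trans Lq _; apply: ler_peMl; [exact: ltW|rewrite /beta; lra].
  have h1 : L ^+ 2 / 4 <= (L - 2 * eta) ^+ 2 by nra.
  have h2 : L ^+ 2 / 4 * (p - q) <= (L - 2 * eta) ^+ 2 * (p - q).
    by rewrite ler_wpM2r// subr_ge0 ltW.
  rewrite /beta; lra.
have T1 : (2 * L * eta + 2 * eta ^+ 2) * b <= v / 16 * b.
  apply: ler_wpM2r; first exact: ltW.
  have : eta ^+ 2 <= L * eta.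
    by rewrite expr2; apply: ler_wpM2r; [exact: ltW|lra].
  lra.
have T2 : 2 * t * K2 * (2 * K2 * b + 8 * eta ^+ 2 * b + L ^+ 2 * p) <= v / 16 * b.
  rewrite -tE -[leRHS]mulrA.
  apply: ler_wpM2l; first by rewrite !mulr_ge0// ltW.
  have : eta ^+ 2 * b <= b.
    apply: ler_piMl; first exact: ltW.
    by rewrite expr_le1//; [lra|exact: ltW].
  rewrite /s; lra.
have T3 : theta * K * b / 2 = v / 16 * b by rewrite -thetaE; ring.
have T4 : kappa * p <= v / 16 * b.
  have k1 : kappa * beta <= v / 16 * L ^+ 2.
    apply: (@le_trans _ _ (v / 16 * L)).
      by rewrite LE lerDr divr_ge0// ltW.
    apply: ler_wpM2l; first by rewrite divr_ge0// ltW.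
    by rewrite expr2 ler_peMl// ltW.
  rewrite -(ler_pM2l L2_gt0).
  have := ler_wpM2l (ltW kappa_gt0) Lp.
  have := ler_wpM2r (ltW b_gt0) k1.
  lra.
move: bal T4; rewrite /kappa.
have -> : p / (2 * t) = (2 * t)^-1 * p by rewrite mulrC.
have := mulr_gt0 v_gt0 b_gt0.
move: T1 T2 T3; lra.
Qed.

End Escape.

(** * Approximation by events of the filtration *)

Section Approximation.
Variables (disp : measure_display) (T : measurableType disp) (R : realType).
Variables (P : probability T R) (F : nat -> set (set T)).
Hypothesis hF : filtration F.
Local Notation pr A := (fine (P A)).

(** This takes the place of a zero-one law: an approximable event of positive probability nearly
    fills some event of some [F n]. *)
Definition approximable (A : set T) : Prop :=
  measurable A /\ forall e : R, 0 < e -> exists n (B : set T),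
    [/\ F n B, pr (A `\` B) <= e & pr (B `\` A) <= e].

Let sF k : sigma_algebra setT (F k). Proof. by case: hF. Qed.
Let subF k : F k `<=` measurable. Proof. by case: hF. Qed.
Let FF j k : (j <= k)%N -> F j `<=` F k. Proof. by case: hF => _ _; exact. Qed.

Lemma approximable_event n (A : set T) : F n A -> approximable A.
Proof.
move=> FA; split=> [|e e0]; first exact: subF FA.
by exists n, A; rewrite setDv measure0/=; split=> //; exact: ltW.
Qed.

Lemma approximableU (A A' : set T) :
  approximable A -> approximable A' -> approximable (A `|` A').
Proof.
move=> [mA hA] [mA' hA']; split=> [|e e0]; first exact: measurableU.
have e2 : 0 < e / 2 by rewrite divr_gt0.
have [n [B [FB AB BA]]] := hA _ e2; have [n' [B' [FB' AB' BA']]] := hA' _ e2.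
have mB := subF FB; have mB' := subF FB'.
have prU (C C1 C2 : set T) : measurable C -> measurable C1 -> measurable C2 ->
    C `<=` C1 `|` C2 -> pr C <= pr C1 + pr C2.
  move=> mC m1 m2 CU; rewrite -fineD ?fin_num_measure// fine_le ?fin_num_measure//.
    by rewrite fin_numD !fin_num_measure.
  apply: le_trans (measureU2 P m1 m2).
  by rewrite le_measure ?inE//; exact: measurableU.
exists (maxn n n'), (B `|` B'); split.
- by apply: eventU => //; [apply: (FF (leq_maxl n n'))|apply: (FF (leq_maxr n n'))].
- rewrite (splitr e) (le_trans (prU _ (A `\` B) (A' `\` B') _ _ _ _))//.
  + by apply: measurableD; exact: measurableU.
  + exact: measurableD.
  + exact: measurableD.
  + by move=> w [[Aw|Aw] /not_orP[nB nB']]; [left|right].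
  + exact: lerD.
- rewrite (splitr e) (le_trans (prU _ (B `\` A) (B' `\` A') _ _ _ _))//.
  + by apply: measurableD; exact: measurableU.
  + exact: measurableD.
  + exact: measurableD.
  + by move=> w [[Aw|Aw] /not_orP[nB nB']]; [left|right].
  + exact: lerD.
Qed.

Lemma pr_nondecreasing (U : nat -> set T) (e : R) : (forall n, measurable (U n)) ->
  nondecreasing_seq U -> 0 < e -> exists n, pr (\bigcup_k U k `\` U n) <= e.
Proof.
move=> mU ndU e0; have mB : measurable (\bigcup_k U k) by exact: bigcupT_measurable.
have : P (U n) @[n --> \oo] --> (fine (P (\bigcup_k U k)))%:E.
  by rewrite fineK ?fin_num_measure//; exact: nondecreasing_cvg_mu.
move=> /fine_cvgP[_] /cvgrPdist_le/(_ _ e0)[n _ /(_ n (leqnn n))/=] h; exists n.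
apply: le_trans (le_trans (ler_norm _) h).
rewrite (@pr_setID _ _ _ P (\bigcup_k U k) (U n))// setIidr; last first.
  by move=> w Uw; exists n.
by rewrite addrC addKr.
Qed.

(** Complementation exchanges the two errors, and a countable union is close to a finite one by
    continuity from below. Conditions on the whole adapted process thus define approximable
    events. *)
Lemma sigma_algebra_approximable : sigma_algebra setT approximable.
Proof.
have s0 : F 0 set0 by apply/(eventP (sF 0)); exact: measurable0.
split.
- exact: approximable_event s0.
- move=> A [mA hA]; split=> [|e e0]; first exact: measurableD.
  have [n [B [FB AB BA]]] := hA _ e0; have mB := subF FB.
  exists n, (setT `\` B); split.
  + apply: eventD => //; apply/(eventP (sF n)); exact: measurableT.
  + apply: le_trans BA; apply: pr_le; try exact: measurableD.
      by apply: measurableD; exact: measurableD.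
    by move=> w [[_ nA] nB]; split=> //; apply: contrapT => h; apply: nB.
  + apply: le_trans AB; apply: pr_le; try exact: measurableD.
      by apply: measurableD; exact: measurableD.
    by move=> w [[_ nB] nA]; split=> //; apply: contrapT => h; apply: nA.
- move=> A hA; pose U n := \big[setU/set0]_(k < n.+1) A k.
  have aU n : approximable (U n).
    rewrite /U; elim: n => [|n ih]; first by rewrite big_ord1.
    by rewrite big_ord_recr/=; exact: approximableU.
  have mU n : measurable (U n) by case: (aU n).
  have UE : \bigcup_k A k = \bigcup_k U k by rewrite /U -bigcup_bigsetU_bigcup.
  have mA : measurable (\bigcup_k A k).
    by apply: bigcupT_measurable => k; case: (hA k).
  split=> // e e0; have e2 : 0 < e / 2 by rewrite divr_gt0.
  have [|n hn] := pr_nondecreasing mU _ e2.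
    by move=> i j ij; apply/subsetPset; exact: subset_bigsetU.
  have [_ /(_ _ e2)[m [B [FB UB BU]]]] := aU n.
  have mB := subF FB; have UA : U n `<=` \bigcup_k A k by rewrite UE => w ?; exists n.
  exists m, B; split=> //.
  + rewrite (@pr_setID _ _ _ P _ (U n))//; last exact: measurableD.
    rewrite (splitr e) addrC lerD//; [|apply: le_trans UB; apply: pr_le].
    * apply: le_trans hn; apply: pr_le; rewrite -?UE; try exact: measurableD.
        by apply: measurableD => //; exact: measurableD.
      by move=> w [[]].
    * by apply: measurableI => //; exact: measurableD.
    * exact: measurableD.
    * by move=> w [[]].
  + apply: le_trans (_ : e / 2 <= e); last lra.
    apply: le_trans BU; apply: pr_le; try exact: measurableD.
    by move=> w [Bw nA]; split=> // /UA.
Qed.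

End Approximation.

(** * Limits expressed by countable conditions *)

Section Convergence.
Variables (R : realType) (d : nat) (dot : {dot 'rV[R]_d for idfun}).
Local Notation nrm := (dot_norm dot).

(** The norm is compared with the coordinates, in one direction through the Gram matrix, in the
    other by [coord_le_dot_norm]. Countable quantifiers let the convergence event be built from
    events on single times. *)
Lemma cvg0_dot_norm (x : nat -> 'rV[R]_d) :
  x n @[n --> \oo] --> (0 : 'rV[R]_d) <->
  forall j : nat, exists l, forall k, (l <= k)%N -> nrm (x k) <= j.+1%:R^-1.
Proof.
split=> [/cvg_ballP x0 j|h].
  pose g := \sum_(i < d) \sum_(i' < d) `|dot 'e_i 'e_i'|.
  have g0 : 0 <= g by apply: sumr_ge0 => i _; exact: sumr_ge0.
  (* The squared norm will be at most [e ^+ 2 * g], and [g <= (1 + g) ^+ 2]. *)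
  pose e : R := j.+1%:R^-1 / (1 + g).
  have e0 : 0 < e by rewrite divr_gt0// ltr_pwDl.
  have [l _ hl] := x0 _ e0; exists l => k lk.
  have [_ /(_ ord0)] := hl _ lk => bx.
  have xe i : `|x k ord0 i| <= e.
    by have := bx i; rewrite /ball/= mxE sub0r normrN => /ltW.
  have : nrm (x k) ^+ 2 <= e ^+ 2 * g.
    rewrite sqr_dot_norm dot_coord /g mulr_sumr; apply: ler_sum => i _.
    rewrite mulr_sumr; apply: ler_sum => i' _.
    apply: le_trans (ler_norm _) _; rewrite !normrM ler_wpM2r// expr2.
    by apply: ler_pM.
  have gg : e ^+ 2 * g <= (j.+1%:R^-1) ^+ 2.
    have -> : (j.+1%:R^-1 : R) = e * (1 + g).
      by rewrite /e divfK// gt_eqF// ltr_pwDl.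
    rewrite [leRHS]exprMn; apply: ler_wpM2l; [exact: sqr_ge0|nra].
  by move=> /le_trans/(_ gg); rewrite ler_pXn2r// nnegrE ?dot_norm_ge0.
apply/cvg_ballP => e e0.
have [C C0 hC] := coord_le_dot_norm dot.
have C1 : 0 < C + 1 by rewrite ltr_wpDl.
have [j hj] : exists j : nat, j.+1%:R^-1 < e / (C + 1).
  have := @near_infty_natSinv_lt R (PosNum (divr_gt0 e0 C1)) => -[j _ /(_ j (leqnn j))].
  by exists j.
have [l hl] := h j; exists l => // k /= lk; split=> // i i'.
rewrite ord1 /ball/= mxE sub0r normrN; apply: le_lt_trans (hC _ _) _.
apply: (@le_lt_trans _ _ ((C + 1) * nrm (x k))).
  by rewrite ler_wpM2r ?dot_norm_ge0// lerDl.
rewrite mulrC -ltr_pdivlMr//; apply: le_lt_trans hj; exact: hl.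
Qed.

(** The inferior limit is the limit of the tail infima, so one of these must be positive. *)
Lemma limn_einf_gt0 (u : nat -> \bar R) : (0 < limn_einf u)%E ->
  exists2 v : R, 0 < v & exists N, forall k, (N <= k)%N -> (v%:E <= u k)%E.
Proof.
move=> u0; have [N uN] : exists N, (0 < einfs u N)%E.
  apply: contrapT => nN; move: u0; rewrite limn_einf_lim ltNge => /negP; apply.
  apply: lime_le; first exact: is_cvg_einfs.
  by apply: nearW => N; rewrite leNgt; apply/negP => uN; apply: nN; exists N.
have [v v0 vu] : exists2 v : R, 0 < v & (v%:E <= einfs u N)%E.
  case: (einfs u N) uN => [x|_|//]; last by exists 1 => //; rewrite leey.
  by rewrite lte_fin => x0; exists x.
exists v => //; exists N => k Nk; apply: le_trans vu _.
by apply: ereal_inf_lbound; exists k.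
Qed.

Lemma limn_esup_lty (u : nat -> \bar R) : (limn_esup u < +oo)%E ->
  exists K : R, exists N, forall k, (N <= k)%N -> (u k <= K%:E)%E.
Proof.
move=> uoo; have [N uN] : exists N, (esups u N < +oo)%E.
  apply: contrapT => nN; move: uoo; rewrite limn_esup_lim ltNge => /negP; apply.
  apply: lime_ge; first exact: is_cvg_esups.
  by apply: nearW => N; rewrite leNgt; apply/negP => uN; apply: nN; exists N.
have [K uK] : exists K : R, (esups u N <= K%:E)%E.
  case: (esups u N) uN => [x _|//|_]; first by exists x.
  by exists 0; rewrite leNye.
exists K, N => k Nk; apply: le_trans uK.
by apply: ereal_sup_ubound; exists k.
Qed.

Lemma tail_sum_le (f : nat -> R) (e : R) : (forall k, 0 <= f k) ->
  (\sum_(0 <= k <oo) (f k)%:E < +oo)%E -> 0 < e ->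
  exists N, forall n l, (N <= n)%N -> \sum_(n <= k < l) f k.+1 <= e.
Proof.
move=> f0 foo e0.
have fE0 k : true -> (0 <= (f k)%:E)%E by rewrite lee_fin.
have := nneseries_tail_cvg foo fE0 => /fine_cvgP[fin] /cvgrPdist_le/(_ _ e0) le.
have [N _ hN] := filterI fin le; exists N => n l Nn.
have [finn] := hN n Nn; rewrite /= sub0r normrN => len.
have -> : \sum_(n <= k < l) f k.+1 = \sum_(n.+1 <= k < l.+1) f k by rewrite big_add1.
rewrite -lee_fin; apply: le_trans (_ : (\sum_(n <= k <oo) (f k)%:E <= e%:E)%E);
  last first.
  by rewrite -(fineK finn) lee_fin; apply: le_trans (ler_norm _) len.
rewrite -sumEFin.
(* The shifted sum starts at [n.+1]; adding the nonnegative [f n] makes it a partial sum of the tail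
   from [n]. *)
apply: le_trans (_ : (\sum_(n <= k < l.+1) (f k)%:E <= _)%E).
  have [nl|ln] := leqP n l; last by rewrite !big_geq// ltnW.
  by rewrite [leRHS]big_ltn ?ltnS// leeDr ?lee_fin.
by apply: nneseries_lim_ge => k _; rewrite lee_fin.
Qed.

End Convergence.

(** * Negligibility of the uniformly well-behaved convergent paths *)

Section Null.
Variables (R : realType) (d : nat) (dot : {dot 'rV[R]_d for idfun}).
Variables (disp : measure_display) (T : measurableType disp).
Variables (P : probability T R) (F : nat -> set (set T)) (gamma c : nat -> R).
Variables (X G eps r : nat -> T -> 'rV[R]_d).
Local Notation nrm := (dot_norm dot).
Local Notation pr A := (fine (P A)).
Hypotheses (hF : filtration F) (gamma_ge0 : forall n, 0 <= gamma n).
Hypothesis c_neq0 : forall N, exists2 n, (N <= n)%N & c n != 0.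
Hypotheses (hX : adapted F X) (hG : adapted F G).
Hypotheses (heps : adapted F eps) (hr : adapted F r).
Hypothesis eps_centered : forall n, condexp_vec P (F n) (eps n.+1) (fun=> 0).
Variables (a : R) (V2 Va : nat -> T -> \bar R).
Hypothesis hV2 : forall n,
  condexp_ge0 P (F n) (fun w => (nrm (eps n.+1 w) ^+ 2)%:E) (V2 n).
Hypothesis hVa : forall n,
  condexp_ge0 P (F n) (fun w => (nrm (eps n.+1 w) `^ a)%:E) (Va n).
Hypothesis a_gt2 : 2 < a.

Definition drifted k w := X k w + gamma k.+1 *: G k w.

Lemma adapted_drifted : adapted F drifted.
Proof.
move=> n i; rewrite /drifted; under eq_fun do rewrite !mxE.
apply: (@measurable_funD _ (g_sigma_algebraType (F n))); first exact: hX.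
apply: (@measurable_funM _ (g_sigma_algebraType (F n))); last exact: hG.
exact: measurable_cst.
Qed.

Lemma dot_norm_drifted k w : 0 <= dot (X k w) (G k w) ->
  nrm (X k w) <= nrm (drifted k w).
Proof.
move=> XG; rewrite -(@ler_pXn2r _ 2)// ?nnegrE ?dot_norm_ge0//.
rewrite !sqr_dot_norm !(dotDl, dotDr, dotZl, dotZr) (dotC dot (G k w)).
rewrite -!addrA lerDl; have g0 := gamma_ge0 k.+1.
have G0 := dot_ge0 dot (G k w).
apply: addr_ge0; first exact: mulr_ge0.
by apply: mulr_ge0 => //; apply: addr_ge0 => //; exact: mulr_ge0.
Qed.

(** The recursion is only almost sure. As the vanishing of the norm of this defect, it becomes a
    condition on adapted variables. *)
Definition rec_defect k w :=
  X k.+1 w - (drifted k w + c k.+1 *: (eps k.+1 w + r k.+1 w)).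

(** The hypotheses with deterministic bounds and a deterministic starting time. [Gamma] is left out
    on purpose: it is an arbitrary event, while these conditions define an approximable one. *)
Definition good (v K eta : R) (N : nat) : set T :=
  [set w | [/\ forall k, (N <= k)%N -> moments_ok v K V2 Va k w /\
                 (0 <= dot (X k w) (G k w) /\ nrm (rec_defect k w) = 0),
     forall n l, (N <= n)%N -> \sum_(n <= k < l) nrm (r k.+1 w) ^+ 2 <= eta ^+ 2
   & forall j : nat, exists l, forall k, (l <= k)%N ->
       nrm (X k w) <= j.+1%:R^-1]].

Let sF k : sigma_algebra setT (F k). Proof. by case: hF. Qed.
Let FF j k : (j <= k)%N -> F j `<=` F k. Proof. by case: hF => _ _; exact. Qed.
Let H := approximable P F.
Let sH : sigma_algebra setT H. Proof. exact: sigma_algebra_approximable. Qed.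

Let wrtH (f : T -> R) k : measurable_wrt (F k) f -> measurable_wrt H f.
Proof.
by apply: measurable_wrtS => // A; exact: approximable_event.
Qed.

Let nrmH (u : T -> 'rV[R]_d) :
  (forall i, measurable_wrt H (fun w => u w ord0 i)) ->
  measurable_wrt H (fun w => nrm (u w)).
Proof. by move=> mu; apply: (@measurable_dot_norm _ _ _ _ (g_sigma_algebraType H)). Qed.

Let nrmXH k : measurable_wrt H (fun w => nrm (X k w)).
Proof. by apply: nrmH => i; apply: wrtH; exact: hX. Qed.

Let H_le (b : R) k : H [set w | nrm (X k w) <= b].
Proof. by apply: event_le => //; exact: measurable_cst. Qed.

Lemma approximable_cvg : H [set w | forall j : nat, exists l, forall k,
  (l <= k)%N -> nrm (X k w) <= j.+1%:R^-1].
Proof.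
apply: event_forall => // j; apply: event_exists => // l.
by apply: event_forall => // k; exact: event_imp.
Qed.

Lemma approximable_good v K eta N : H (good v K eta N).
Proof.
rewrite (_ : good v K eta N =
    [set w | forall k, (N <= k)%N -> moments_ok v K V2 Va k w /\
       (0 <= dot (X k w) (G k w) /\ nrm (rec_defect k w) = 0)] `&`
    ([set w | forall n l, (N <= n)%N ->
       \sum_(n <= k < l) nrm (r k.+1 w) ^+ 2 <= eta ^+ 2] `&`
     [set w | forall j : nat, exists l, forall k, (l <= k)%N ->
       nrm (X k w) <= j.+1%:R^-1])); last first.
  by apply/seteqP; split=> w /= => [[h1 h2 h3]|[h1 [h2 h3]]].
apply: eventI => //; last apply: eventI => //; last exact: approximable_cvg.
- apply: event_forall => // k; apply: event_imp => //.
  apply: (eventI sH (A := moments_ok v K V2 Va k)).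
    apply: (@approximable_event _ _ _ _ _ hF k).
    exact: (F_moments_ok hF v K hV2 hVa).
  apply: (eventI sH (A := [set w | 0 <= dot (X k w) (G k w)])).
    apply: event_le => //; first exact: measurable_cst.
    apply: (@measurable_dot _ _ _ _ (g_sigma_algebraType H)) => i.
      by apply: wrtH; exact: hX.
    by apply: wrtH; exact: hG.
  apply: event_eq => //; last exact: measurable_cst.
  apply: nrmH => i; rewrite /rec_defect; under eq_fun do rewrite !mxE.
  apply: (@wrtH _ k.+1).
  apply: (@measurable_funB _ (g_sigma_algebraType (F k.+1))); first exact: hX.
  apply: (@measurable_funD _ (g_sigma_algebraType (F k.+1))).
    apply: (@measurable_wrtS _ _ _ _ (F k)) => //; first exact: FF.
    apply: (@measurable_funD _ (g_sigma_algebraType (F k))); first exact: hX.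
    apply: (@measurable_funM _ (g_sigma_algebraType (F k))); last exact: hG.
    exact: measurable_cst.
  apply: (@measurable_funM _ (g_sigma_algebraType (F k.+1))).
    exact: measurable_cst.
  apply: (@measurable_funD _ (g_sigma_algebraType (F k.+1))).
    exact: heps.
  exact: hr.
- apply: event_forall => // n; apply: event_forall => // l.
  apply: event_imp => //; apply: event_le => //; last exact: measurable_cst.
  apply: (@measurable_sum _ (g_sigma_algebraType H)) => k.
  apply: (@measurable_funX _ (g_sigma_algebraType H)).
  by apply: nrmH => i; apply: wrtH; exact: hr.
Qed.

(** If such an event had positive probability, it would fill some [B] of some [F n] almost entirely,
    against the proportion [delta] of [horizon_escape]. The same [eta] serves all [N]. *)
Lemma good_null (v K : R) : 0 < v -> 0 < K ->
  exists2 eta : R, 0 < eta & forall N, P (good v K eta N) = 0%E.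
Proof.
move=> v0 K0.
have [delta [eta [delta0 eta0 esc]]] := horizon_escape hF adapted_drifted heps
  eps_centered hV2 hVa a_gt2 v0 K0.
exists eta => // N; set A := good v K eta N.
have HA : H A by exact: approximable_good.
have [mA hA] := HA.
suff : pr A = 0 by move=> h; rewrite -[LHS]fineK ?h// fin_num_measure.
apply/eqP; rewrite eq_le pr_ge0 andbT leNgt; apply/negP => A0.
(* The first bound gives [pr B >= pr A / 2]; the second keeps two errors [e] within
   [delta * pr A / 4], less than [delta * pr B]. *)
pose e := pr A * Num.min 2^-1 (delta / 8).
have m0 : 0 < Num.min 2^-1 (delta / 8) by rewrite lt_min invr_gt0 ltr0n divr_gt0.
have e0 : 0 < e by rewrite mulr_gt0.
have e1 : e <= pr A / 2 by rewrite ler_wpM2l ?ge_min ?lexx// ltW.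
have e2 : e <= pr A * (delta / 8).
  by apply: ler_wpM2l; [exact: ltW|rewrite ge_min lexx orbT].
clearbody e.
have [n0 [B [FB AB BA]]] := hA _ e0.
pose n := maxn N n0.
have FnB : F n B by apply: (FF (leq_maxr N n0)).
have mB : measurable B by case: hF => _ sub _; exact: sub FB.
(* Some [c j.+1] with [n <= j] is nonzero, so every horizon from [n] to beyond [j] has positive
   scale. *)
have [[//|j] nj cj] := c_neq0 n.+1.
have s_mono m : (j < m)%N ->
    0 < \sum_(n <= k < j.+1) c k.+1 ^+ 2 <= \sum_(n <= k < m) c k.+1 ^+ 2.
  move=> jm; rewrite (big_cat_nat (ltnW nj) jm).
  have p1 : 0 <= \sum_(j.+1 <= k < m) c k.+1 ^+ 2.
    by apply: sumr_ge0 => k _; exact: sqr_ge0.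
  rewrite /= lerDl p1 andbT big_nat_recr//= ltr_wpDl ?exprn_even_gt0//.
  by apply: sumr_ge0 => k _; exact: sqr_ge0.
(* The threshold uses the scale of the shortest such horizon: it is fixed before [m], and a larger
   [m] only increases the scale. *)
pose xi := eta * Num.sqrt (\sum_(n <= k < j.+1) c k.+1 ^+ 2).
have xi0 : 0 < xi.
  by rewrite mulr_gt0// sqrtr_gt0; case/andP: (s_mono _ (ltnSn j)).
pose I l := A `&` [set w | forall k, (l <= k)%N -> nrm (X k w) <= xi].
have mI l : measurable (I l).
  suff [] : H (I l) by [].
  by apply: (eventI sH) => //; apply: event_forall => // k; exact: event_imp.
have IA : \bigcup_l I l = A.
  apply/seteqP; split=> w; first by move=> [l _ []].
  move=> Aw; case: (Aw) => _ _ X0.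
  have [i hi] : exists i : nat, i.+1%:R^-1 < xi.
    have := @near_infty_natSinv_lt R (PosNum xi0) => -[i _ /(_ i (leqnn i))].
    by exists i.
  have [l hl] := X0 i; exists l => //; split=> // k lk.
  exact: le_trans (hl k lk) (ltW hi).
have [l Il] : exists l, pr (A `\` I l) <= e.
  have ndI : nondecreasing_seq I.
    move=> l1 l2 l12; apply/subsetPset => w [Aw h]; split=> // k lk.
    by apply: h; exact: leq_trans lk.
  by have := pr_nondecreasing P mI ndI e0; rewrite IA.
(* Late enough for the paths of [I l] to be below [xi] and for the scale to be positive. *)
pose m := maxn l j.+1; pose D := B `&` I l.
have jm : (j < m)%N by exact: leq_maxr.
have mD : measurable D by exact: measurableI.
have BD : pr (B `\` D) <= e + e.
  rewrite (@pr_setID _ _ _ P _ A)//; last exact: measurableD.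
  rewrite addrC lerD//; [apply: le_trans BA|apply: le_trans Il]; apply: pr_le.
  - by apply: measurableD => //; exact: measurableD.
  - exact: measurableD.
  - by move=> w [[]].
  - by apply: measurableI => //; exact: measurableD.
  - exact: measurableD.
  - by move=> w [[Bw nD] Aw]; split=> // Iw; apply: nD.
have prB : pr A <= pr B + e.
  rewrite (@pr_setID _ _ _ P A B)//; apply: lerD; last exact: AB.
  by apply: pr_le => //; exact: measurableI.
have : delta * pr B <= pr (B `\` D).
  apply: (esc X r c n m) => //.
  - by move=> w [].
  - by have /andP[] := s_mono m jm; exact: lt_le_trans.
  - move=> w [_ [[ok _ _] _]] k /andP[nk _].
    have [mok [XG rec]] := ok k (leq_trans (leq_maxl N n0) nk).
    split=> //; first exact: dot_norm_drifted.
    by apply/eqP; rewrite -subr_eq0; apply/eqP; exact: dot_norm_eq0 rec.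
  - by move=> w [_ [[_ hr' _] _]]; apply: hr'; exact: leq_maxl.
  - move=> w [_ [_ h]]; apply: le_trans (h m (leq_maxl _ _)) _.
    rewrite ler_wpM2l ?(ltW eta0)// ler_sqrt; first by case/andP: (s_mono m jm).
    by have /andP[+ _] := s_mono m jm; move=> /ltW/le_trans; apply;
      case/andP: (s_mono m jm).
move=> h; have := ler_wpM2l (ltW delta0) prB.
have := ler_wpM2l (ltW delta0) e1.
have := mulr_gt0 delta0 A0.
lra.
Qed.

End Null.

(** * Reduction to countably many null events *)

Theorem theorem2p2p1 (R : realType) (d : nat)
    (dot : {dot 'rV[R]_d for idfun})
    (disp : measure_display) (T : measurableType disp) (P : probability T R)
    (F : nat -> set (set T)) (gamma c : nat -> R)
    (X G eps r : nat -> T -> 'rV[R]_d)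
    (hF : filtration F)
    (gamma_ge0 : forall n, 0 <= gamma n)
    (c_ge0 : forall n, 0 <= c n)
    (c_neq0 : forall N, exists2 n, (N <= n)%N & c n != 0)
    (c_sq : (\sum_(0 <= n <oo) (c n ^+ 2)%:E < +oo)%E)
    (hX : adapted F X) (hG : adapted F G)
    (heps : adapted F eps) (hr : adapted F r)
    (eps_centered : forall n, condexp_vec P (F n) (eps n.+1) (fun=> 0))
    (* V2 n is a version of E[ |eps_{n+1}|^2 | F_n ] *)
    (V2 : nat -> T -> \bar R)
    (hV2 : forall n,
      condexp_ge0 P (F n) (fun w => (dot_norm dot (eps n.+1 w) ^+ 2)%:E) (V2 n))
    (V2_fin : forall n, {ae P, forall w, (V2 n w < +oo)%E})
    (X_rec : forall n, {ae P, forall w,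
      X n.+1 w - X n w
      = gamma n.+1 *: G n w + c n.+1 *: (eps n.+1 w + r n.+1 w)})
    (Gamma : set T) (mGamma : measurable Gamma)
    (T0 : {RV P >-> R}) (a rho : R) (a_gt2 : 2 < a) (rho_gt0 : 0 < rho)
    (* Va n is a version of E[ |eps_{n+1}|^a | F_n ] *)
    (Va : nat -> T -> \bar R)
    (hVa : forall n,
      condexp_ge0 P (F n) (fun w => (dot_norm dot (eps n.+1 w) `^ a)%:E) (Va n))
    (G_outward : {ae P, forall w, Gamma w -> forall n,
      T0 w <= n%:R -> dot_norm dot (X n w) < rho -> 0 <= dot (X n w) (G n w)})
    (eps_moments : {ae P, forall w, Gamma w ->
      (0 < limn_einf (fun n => V2 n w))%E /\
      (limn_esup (fun n => Va n w) < +oo)%E})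
    (r_sq : {ae P, forall w, Gamma w ->
      (\sum_(0 <= n <oo) (dot_norm dot (r n w) ^+ 2)%:E < +oo)%E}) :
  P (Gamma `&` [set w | X n w @[n --> \oo] --> (0 : 'rV[R]_d)]) = 0%E.
Proof.
pose Z := [set w | forall j : nat, exists l, forall k, (l <= k)%N ->
  dot_norm dot (X k w) <= j.+1%:R^-1].
have -> : [set w | X n w @[n --> \oo] --> (0 : 'rV[R]_d)] = Z.
  apply/seteqP; split=> w; first by move/(cvg0_dot_norm dot).
  by move=> Zw; apply/(cvg0_dot_norm dot).
have mZ : measurable Z by case: (approximable_cvg dot P hF hX).
(* A single integer gives both moment bounds, so countably many events [good] suffice. *)
pose v p : R := p.+1%:R^-1; pose K p : R := p.+1%:R.
have /choice[eta eta_null] p : exists eta : R, 0 < eta /\ forall N,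
    P (good dot gamma c X G eps r V2 Va (v p) (K p) eta N) = 0%E.
  have v0 : 0 < v p by rewrite invr_gt0.
  have K0 : 0 < K p by rewrite ltr0n.
  have [eta eta0 h] := good_null hF gamma_ge0 c_neq0 hX hG heps hr eps_centered
    hV2 hVa a_gt2 v0 K0.
  by exists eta.
pose A p N := good dot gamma c X G eps r V2 Va (v p) (K p) (eta p) N.
have mA p N : measurable (A p N).
  by case: (approximable_good gamma c hF hX hG heps hr hV2 hVa
    (v p) (K p) (eta p) N).
have /ae_foralln rec := X_rec.
apply: measure_negligible; first exact: measurableI.
have [M [mM M0 subM]] := filterI (filterI rec G_outward) (filterI eps_moments r_sq).
(* All almost sure hypotheses hold outside the null set [M]; every other convergent path of [Gamma]
   is put in some [A p N]. *)
apply: (@negligibleS _ _ _ _ (M `|` \bigcup_p \bigcup_N A p N)); last first.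
  apply: negligibleU; first by apply/negligibleP.
  apply: negligible_bigcup => p; apply: negligible_bigcup => N.
  by apply/negligibleP => //; case: (eta_null p) => _; exact.
move=> w [Gw Zw]; have [Mw|nMw] := pselect (M w); first by left.
have [[recw outw] [momw rw]] := contrapT (fun h => nMw (subM w h)).
right; have [V2w Vaw] := momw Gw.
have [v0 v0_gt0 [N1 hN1]] := limn_einf_gt0 V2w.
have [K0 [N2 hN2]] := limn_esup_lty Vaw.
have [p [vp Kp]] : exists p, v p <= v0 /\ K0 <= K p.
  have := @near_infty_natSinv_lt R (PosNum v0_gt0) => -[i _ hi].
  exists (maxn i (Num.truncn `|K0|)); split.
    by apply/ltW/hi; exact: leq_maxl.
  apply: le_trans (ler_norm _) _; apply: ltW.
  apply: lt_le_trans (truncnS_gt _) _.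
  by rewrite /K ler_nat ltnS leq_maxr.
have [eta0 _] := eta_null p.
have e2 : 0 < eta p ^+ 2 by rewrite exprn_gt0.
have [N3 hN3] := tail_sum_le (fun k => sqr_ge0 (dot_norm dot (r k w))) (rw Gw) e2.
have [i hi] : exists i : nat, i.+1%:R^-1 < rho.
  have := @near_infty_natSinv_lt R (PosNum rho_gt0) => -[i _ /(_ i (leqnn i))].
  by exists i.
have [N4 hN4] := Zw i.
(* From [N5] on the time exceeds [T0 w], and from [N4] on the path is within [rho] of 0, so the
   drift points outward. *)
pose N5 := (Num.truncn `|T0 w|).+1.
exists p => //; exists (maxn (maxn N1 N2) (maxn N3 (maxn N4 N5))) => //.
split=> // [k|n l]; rewrite !geq_max => /andP[/andP[k1 k2] /and3P[k3 k4 k5]]; last first.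
  exact: hN3.
split; [split|split].
- by apply: le_trans (hN1 k k1); rewrite lee_fin.
- by apply: le_trans (hN2 k k2) _; rewrite lee_fin.
- apply: outw => //; last exact: le_lt_trans (hN4 k k4) hi.
  apply: le_trans (ler_norm _) _; apply: ltW.
  by apply: lt_le_trans (truncnS_gt _) _; rewrite ler_nat.
- rewrite /rec_defect /drifted.
  have -> : X k.+1 w = X k w + (X k.+1 w - X k w) by rewrite addrC subrK.
  by rewrite recw addrA subrr dot_norm0.
Qed.
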